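(* Assume (A1) and (A2). Suppose $\nu\in\mathcal P_f(X)$ is a product measure on $X=\mathbb R^S$ and $\mu$ is a limit point of $\{\nu S(t):t\ge0\}$ as $t\to\infty$, i.e. $\mu=\lim_{n\to\infty}\nu S(t_n)$ for some sequence $t_n\uparrow\infty$, where $S(t)$ denotes the semigroup of the BMP process. Then for all $n\ge1$ and $x_1,\dots,x_n\in S$, $$K_\mu(x_1,\dots,x_n)\ \ge\ \prod_{i=1}^nK_\mu(x_i).$$
   Context: $S$ is either a finite set or $S=\mathbb Z^d$. $p(x,y)$ is an irreducible symmetric random walk transition probability on $S$: $p(x,y)=p(y,x)\ge 0$, $\sum_y p(x,y)=1$, $p(x,x)=0$. If $S=\mathbb Z^d$, $p$ is moreover translation invariant and of finite range. The Brownian momentum process (BMP) is the Markov diffusion process on $X=\mathbb R^S$ with (formal) generator on local smooth functions $$L_{BMP}f(\eta)=\sum_{\{x,y\}\subset S}p(x,y)\Big(\eta_x\frac{\partial}{\partial\eta_y}-\eta_y\frac{\partial}{\partial\eta_x}\Big)^2f(\eta)$$ (sum over unordered pairs). $\nu S(t)$ is the law at time $t$ when started from $\nu$. For $\xi\in\mathbb N^S$ with $|\xi|=\sum_x\xi_x<\infty$, $$D(\xi,\eta)=\prod_{x\in S}\frac{\eta_x^{2\xi_x}}{(2\xi_x-1)!!}\qquad((-1)!!=1).$$ If $S=\mathbb Z^d$, the BMP is started from tempered configurations (at most polynomially growing; this holds $\nu$-a.s. for $\nu\in\mathcal P_f(X)$) and satisfies the duality relation $\mathbb E^{BMP}_\eta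 D(\xi,\eta_t)=\mathbb E^{SIP(1)}_\xi D(\xi_t,\eta)$, where SIP$(1)$ is the particle process on finite configurations $\xi$ in which a particle jumps from $x$ to $y$ at rate $p(x,y)2\xi_x(1+2\xi_y)$. $\sum_{i=1}^n\delta_{x_i}$ is the configuration $\xi$ with $\xi(x)=\sum_iI(x_i=x)$, and $K_\mu(x_1,\dots,x_n)=\int D(\sum_{i=1}^n\delta_{x_i},\eta)\,\mu(d\eta)$. $\mathcal P_f(X)$ is the set of probability measures $\mu$ on $X$ with $\sup_{|\xi|=n}\int D(\xi,\eta)\mu(d\eta)<\infty$ for every $n\in\mathbb N$. Convergence $\mu_n\to\mu$ means $\int D(\xi,\eta)\mu_n(d\eta)\to\int D(\xi,\eta)\mu(d\eta)$ for every finite $\xi$. (A1) (with $m=1$): $\lim_{t\to\infty}\sup_{x,y}\mathbb P^{IRW}_{x,y}(X_t=Y_t)=0$, where $X_t,Y_t$ are independent continuous-time random walks started at $x,y$, each jumping at rate $2$ according to $p$. (A2) (with $m=1$): $\lim_{t\to\infty}\sup_{x,y}\mathbb P^{SIP(1)}_{x,y}(X'_t=Y'_t)=0$, where $(X'_t,Y'_t)$ are two labelled SIP$(1)$ particles started at $x,y$: the Markov chain on $S^2$ in which the particle at $x_i$ jumps to $z$ at rate $2p(x_i,z)\big(1+2\sum_{j=1}^2I(z=x_j)\big)$. *)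

(* Defs.v *)
From HB Require Import structures.
From mathcomp Require Import all_boot all_order all_algebra.
From mathcomp Require Import finmap multiset.
From mathcomp Require Import all_classical all_reals all_analysis.

Set Implicit Arguments.
Unset Strict Implicit.
Unset Printing Implicit Defensive.

Import Order.TTheory GRing.Theory Num.Theory.
Import numFieldNormedType.Exports.

Local Open Scope classical_set_scope.
Local Open Scope ring_scope.

Inductive site_space := FiniteSet of finType | Lattice of nat.

Definition sites (S : site_space) : countType :=
  match S with FiniteSet T => T | Lattice d => 'rV[int]_d end.

Definition is_lattice (S : site_space) : bool :=
  if S is Lattice _ then true else false.

Notation particles S := {mset (sites S)}%mset.

Definition site_norm d (x : 'rV[int]_d) : nat := (\sum_(i < d) `|x ord0 i|)%N.

Definition homogeneous (R : realType) (S : site_space) :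
    (sites S -> sites S -> R) -> Prop :=
  match S return (sites S -> sites S -> R) -> Prop with
  | FiniteSet _ => fun _ => True
  | Lattice d => fun p =>
      (forall x y z : 'rV[int]_d, p (x + z) (y + z) = p x y) /\
      (exists r : nat, forall x y : 'rV[int]_d,
         (r < site_norm (y - x))%N -> p x y = 0)
  end.

Record random_walk (R : realType) (S : site_space)
    (p : sites S -> sites S -> R) : Prop := {
  rw_ge0 : forall x y, 0 <= p x y;
  rw_sym : forall x y, p x y = p y x;
  rw_sum1 : forall x, \esum_(y in [set: sites S]) (p x y)%:E = 1%E;
  rw_diag : forall x, p x x = 0;
  rw_irreducible : forall x y, exists s : seq (sites S),
    path (fun a b => 0 < p a b) x s /\ last x s = y;
  rw_homogeneous : homogeneous p }.

(* [P t a b] is the transition function of the continuous-time Markov chain on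
   [A] that jumps from [a] to [b] at rate [q a b]. The sum in the backward
   equation is a finite-support sum: it is meant for rates such that
   [q a b != 0] for only finitely many [b], which holds for the chains below
   because the underlying walk has finite range. *)
Record markov_transition (R : realType) (A : choiceType) (q : A -> A -> R)
    (P : R -> A -> A -> R) : Prop := {
  mt_ge0 : forall (t : R) a b, 0 <= t -> 0 <= P t a b;
  mt_sum1 : forall (t : R) a, 0 <= t -> \esum_(b in [set: A]) (P t a b)%:E = 1%E;
  mt_start : forall a b, P 0 a b = (a == b)%:R;
  mt_semigroup : forall (s t : R) a b, 0 <= s -> 0 <= t ->
    (P (s + t) a b)%:E = \esum_(c in [set: A]) (P s a c * P t c b)%:E;
  mt_right_continuous : forall a b, P t a b @[t --> 0^'+] --> P 0 a b;
  mt_backward : forall (t : R) a b, 0 < t ->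
    is_derive t 1 (fun s : R => P s a b : R)
      (\sum_(c \in [set: A]) q a c * (P t c b - P t a b)) }.

Section Particles.
Context {R : realType} {S : site_space}.
Variable p : sites S -> sites S -> R.

Definition walk_rate (x y : sites S) : R := 2 * p x y.

(* Labelled SIP(1) pair; at most one of the two summands is nonzero since
   [p x x = 0]. *)
Definition sip2_rate (a b : sites S * sites S) : R :=
  let jump x z := 2 * p x z * (1 + 2 * ((z == a.1)%:R + (z == a.2)%:R)) in
  (a.2 == b.2)%:R * jump a.1 b.1 + (a.1 == b.1)%:R * jump a.2 b.2.

Definition move (xi : particles S) (x y : sites S) : particles S :=
  ([mset y] `+` (xi `\ x))%mset.

(* At most one pair (x, y) with x != y contributes for given [xi] and [xi']. *)
Definition sip_rate (xi xi' : particles S) : R :=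
  \sum_(x <- finsupp xi) \sum_(y <- finsupp xi' | xi' == move xi x y)
    p x y * (2 * xi x)%N%:R * (1 + 2 * xi y)%N%:R.

(* The probability that two independent walkers, each with transition function
   [W], are at the same site at time [t] is the sum over [z] below. *)
Definition irw_meeting_vanishes (W : R -> sites S -> sites S -> R) : Prop :=
  ereal_sup [set \esum_(z in [set: sites S]) (W t xy.1 z * W t xy.2 z)%:E
            | xy in [set: sites S * sites S]] @[t --> +oo] --> 0%E.

Definition sip_meeting_vanishes
    (P2 : R -> sites S * sites S -> sites S * sites S -> R) : Prop :=
  ereal_sup [set \esum_(z in [set: sites S]) (P2 t xy (z, z))%:E
            | xy in [set: sites S * sites S]] @[t --> +oo] --> 0%E.

End Particles.

(* The product sigma-algebra on R^S is generated by one-site cylinders. *)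
Definition cylinder (R : realType) (S : site_space) : set (set (sites S -> R)) :=
  [set C | exists (x : sites S) (B : set (measurableTypeR R)),
     measurable B /\ C = [set eta | B (eta x)]].

Notation config R S := (g_sigma_algebraType (@cylinder R S)).

Definition tempered (R : realType) (S : site_space) : set (sites S -> R) :=
  match S return set (sites S -> R) with
  | FiniteSet _ => setT
  | Lattice d => [set eta | exists (C : R) (k : nat), forall x : 'rV[int]_d,
      `|eta x| <= C * (1 + site_norm x)%N%:R ^+ k]
  end.

(* (2k - 1)!! = 1 * 3 * ... * (2k - 1) *)
Definition odd_fact (k : nat) : nat := (\prod_(i < k) (2 * i + 1))%N.

Definition D (R : realType) (S : site_space) (xi : particles S)
    (eta : sites S -> R) : R :=
  \prod_(x <- finsupp xi) (eta x ^+ (2 * xi x)%N / (odd_fact (xi x))%:R).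

Section Generator.
Context {R : realType} {S : site_space}.
Implicit Types (eta : sites S -> R) (f : (sites S -> R) -> R).

Definition upd eta (x : sites S) (r : R) : sites S -> R :=
  fun y => if y == x then r else eta y.

Definition partial (x : sites S) f : (sites S -> R) -> R :=
  fun eta => derive1 (fun r : R => f (upd eta x r)) (eta x).

(* Local smooth functions; all derivatives are required to grow at most
   polynomially, so that expectations under the process make sense. *)
Definition local_smooth f : Prop :=
  exists F : {fset (sites S)},
    (forall eta eta', {in F, eta =1 eta'} -> f eta = f eta') /\
    (forall s : seq (sites S), let g := foldr partial f s in
      [/\ continuous (g : {ptws sites S -> R} -> R),
          forall x eta, derivable (fun r => g (upd eta x r)) (eta x) 1 &
          exists (C : R) (k : nat), forall eta,
            `|g eta| <= C * (1 + \sum_(x <- F) `|eta x|) ^+ k]).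

Definition rotation (x y : sites S) f : (sites S -> R) -> R :=
  fun eta => eta x * partial y f eta - eta y * partial x f eta.

(* Each unordered pair {x, y} is counted twice in the sum over ordered pairs,
   with equal contributions; the diagonal does not contribute. For local [f]
   only finitely many pairs contribute. *)
Definition bmp_generator (p : sites S -> sites S -> R) f : (sites S -> R) -> R :=
  fun eta => 2^-1 * \sum_(xy \in [set: sites S * sites S])
    p xy.1 xy.2 * rotation xy.1 xy.2 (rotation xy.1 xy.2 f) eta.

End Generator.

(* [B t eta] is the law at time [t] of the Brownian momentum process started
   from the tempered configuration [eta]; the values of the kernels at other
   configurations are irrelevant. [Q] is the SIP(1) transition function. *)
Record brownian_momentum (R : realType) (S : site_space)
    (p : sites S -> sites S -> R)
    (Q : R -> particles S -> particles S -> R)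
    (B : R -> R.-pker (config R S) ~> (config R S)) : Prop := {
  bmp_start : forall (eta : config R S) A, tempered eta -> measurable A ->
    B 0 eta A = \d_eta A;
  bmp_tempered : forall (t : R) (eta : config R S), 0 <= t -> tempered eta ->
    {ae B t eta, forall zeta, tempered zeta};
  bmp_markov : forall (s t : R) (eta : config R S) A,
    0 <= s -> 0 <= t -> tempered eta -> measurable A ->
    B (s + t) eta A = (\int[B s eta]_zeta B t zeta A)%E;
  bmp_integrable : forall f (t : R) (eta : config R S),
    local_smooth f -> 0 <= t -> tempered eta ->
    (B t eta).-integrable setT (EFin \o f) /\
    (B t eta).-integrable setT (EFin \o bmp_generator p f);
  bmp_right_continuous : forall f (eta : config R S),
    local_smooth f -> tempered eta ->
    \int[B t eta]_zeta f zeta @[t --> 0^'+] --> f eta;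
  bmp_forward : forall f (t : R) (eta : config R S),
    local_smooth f -> 0 < t -> tempered eta ->
    is_derive t 1 (fun s : R => \int[B s eta]_zeta f zeta)
      (\int[B t eta]_zeta bmp_generator p f zeta);
  bmp_duality : is_lattice S ->
    forall (t : R) xi (eta : config R S), 0 <= t -> tempered eta ->
    (\int[B t eta]_zeta (D xi zeta)%:E)%E =
    \esum_(xi' in [set: particles S]) (Q t xi xi' * D xi' eta)%:E }.

Section Evolve.
Context {R : realType} {S : site_space}.
Variables (nu : probability (config R S) R)
  (P : R.-pker (config R S) ~> (config R S)).
Local Open Scope ereal_scope.

(* The law at the terminal time when the initial law is [nu]. *)
Definition evolve (A : set (config R S)) : \bar R := \int[nu]_eta P eta A.

Let evolve0 : evolve set0 = 0.
Proof. by rewrite /evolve integral0_eq// => eta _; rewrite measure0. Qed.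

Let evolve_ge0 A : 0 <= evolve A.
Proof. exact: integral_ge0. Qed.

Let evolve_sigma_additive : semi_sigma_additive evolve.
Proof.
move=> U mU tU mUU; rewrite [X in _ --> X](_ : _ =
  \int[nu]_eta (\sum_(n <oo) P eta (U n))); last first.
  apply: eq_integral => eta _.
  by apply/esym/cvg_lim => //; exact/measure_semi_sigma_additive.
apply/cvg_closeP; split.
  by apply: is_cvg_nneseries => n _ _; exact: integral_ge0.
rewrite closeE// integral_nneseries// => n.
exact: measurable_kernel.
Qed.

HB.instance Definition _ := isMeasure.Build _ _ R
  evolve evolve0 evolve_ge0 evolve_sigma_additive.

Let evolve_setT : evolve setT = 1.
Proof.
rewrite /evolve (eq_integral (cst 1)) ?integral_cst//= ?mul1e ?probability_setT//.
by move=> eta _; rewrite prob_kernel.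
Qed.

HB.instance Definition _ :=
  Measure_isProbability.Build _ _ R evolve evolve_setT.

End Evolve.

Section Measures.
Context {R : realType} {S : site_space}.
Implicit Types mu nu : probability (config R S) R.
Local Open Scope ereal_scope.

Definition K mu (x : seq (sites S)) : \bar R :=
  \int[mu]_eta (D (seq_mset x) eta)%:E.

Definition finite_moments mu : Prop := forall n : nat,
  ereal_sup [set \int[mu]_eta (D xi eta)%:E
            | xi in [set xi : particles S | size xi = n]] < +oo.

Definition product_measure nu : Prop :=
  exists m : sites S -> probability (measurableTypeR R) R,
  forall (F : {fset (sites S)}) (A : sites S -> set (measurableTypeR R)),
    (forall x, measurable (A x)) ->
    nu [set eta | forall x, x \in F -> A x (eta x)] = \prod_(x <- F) m x (A x).

Definition moment_cvg (mu_ : nat -> probability (config R S) R) mu : Prop :=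
  forall xi : particles S,
    \int[mu_ n]_eta (D xi eta)%:E @[n --> \oo] --> \int[mu]_eta (D xi eta)%:E.

End Measures.

(* Main.v *)
(* By duality the moments of the law at time t are K(xi) = E_xi[M(xi_t)], where
   xi_t is SIP(1) and M(xi) is the D(xi)-moment of the initial product law; M
   equals the product of the one-site second moments rho on configurations
   without coincidences. The function prod_i h_t(x_i), with h_t the evolution of
   rho under one walk, solves the equation of independent walks and is a
   subsolution of the SIP(1) equation, because the attraction terms sum up to
   squares. Hence E_xi[prod rho] >= prod_i K_t(x_i) up to the probability of a
   coincidence. By consistency of SIP(1), this probability is at most the sum
   over pairs of the probability that two SIP(1) particles meet, which vanishes
   by (A2). All evolutions are compared through a maximum principle for bounded
   jump generators, applied to finite sums of transition probabilities. On a
   finite set (A1) fails, so only the lattice matters. *)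

Require Import Defs.
From HB Require Import structures.
From mathcomp Require Import all_boot all_order all_algebra.
From mathcomp Require Import finmap multiset.
From mathcomp Require Import all_classical all_reals all_analysis.
From mathcomp Require Import measurable_realfun.
From mathcomp Require Import zify ring lra.

Set Implicit Arguments.
Unset Strict Implicit.
Unset Printing Implicit Defensive.

Import Order.TTheory GRing.Theory Num.Theory.
Import numFieldNormedType.Exports.

Local Open Scope classical_set_scope.
Local Open Scope ring_scope.

(** * Comparison principle *)

(** The backward equation is available for one entry of [Q] at a time, so no infinite sum is ever
    differentiated: [rho] is cut off to a finite set of sites, the comparison is made for finite
    sums, and only then do lattice balls exhaust the sites at fixed time. Dropping terms is
    harmless, since they are nonnegative and only a lower bound is sought. Labels ['I_n] are carried
    through the comparison because for fixed n the total jump rate is bounded and moving one label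
    changes one factor of a product. The one-particle evolution is read off from [Q] on singletons,
    so both sides come from the same equation. The error is [r ^+ n * n ^ 2 * e], where [r] bounds
    the second moments, [n ^ 2] the number of pairs, and [e] the meeting probability uniformly over
    starting pairs; its coefficient is free of t, which lets t tend to infinity last. *)

Section Comparison.
Context {R : realType}.

(* The time regularity that [markov_transition] gives to transition functions. *)
Definition smooth_from0 (f df : R -> R) : Prop :=
  (f t @[t --> 0^'+] --> f 0) /\ forall t : R, 0 < t -> is_derive t 1 f (df t).

Lemma smooth_from0_le (f df : R -> R) (t : R) : smooth_from0 f df -> 0 <= t ->
  (forall s, 0 < s -> s < t -> 0 <= df s) -> f 0 <= f t.
Proof.
move=> [f0 fd]; rewrite le_eqVlt => /predU1P[<-//|t0] df0.
have der s : s \in `]0, t[%R -> is_derive s 1 f (df s).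
  by rewrite in_itv/= => /andP[s0 _]; exact: fd.
have cf : {within `[0, t], continuous f}.
  apply/continuous_within_itvP => //; split=> //.
  - move=> s; rewrite in_itv/= => /andP[s0 _].
    by apply/differentiable_continuous/derivable1_diffP; case: (fd s s0).
  - apply: cvg_at_left_filter.
    by apply/differentiable_continuous/derivable1_diffP; case: (fd t t0).
have [c] := MVT t0 der cf; rewrite in_itv/= => /andP[c0 ct].
move=> /eqP; rewrite subr_eq subr0 => /eqP ->.
by rewrite lerDr mulr_ge0// ?df0// ltW.
Qed.

Lemma is_derive_smooth_from0 (f df : R -> R) :
  (forall t : R, is_derive t 1 f (df t)) -> smooth_from0 f df.
Proof.
move=> fd; split=> //; apply: cvg_at_right_filter.
by apply/differentiable_continuous/derivable1_diffP; case: (fd 0).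
Qed.

Lemma smooth_from0_cst (c : R) : smooth_from0 (fun=> c) (fun=> 0).
Proof. by split; [exact: cvg_cst|move=> t _; exact: is_derive_cst]. Qed.

Lemma smooth_from0D (f df g dg : R -> R) : smooth_from0 f df ->
  smooth_from0 g dg ->
  smooth_from0 (fun t => f t + g t) (fun t => df t + dg t).
Proof.
move=> [f0 fd] [g0 gd]; split; first exact: cvgD.
by move=> t t0; have fdt := fd t t0; have gdt := gd t t0; exact: is_deriveD.
Qed.

Lemma smooth_from0M (f df g dg : R -> R) : smooth_from0 f df ->
  smooth_from0 g dg ->
  smooth_from0 (fun t => f t * g t) (fun t => df t * g t + f t * dg t).
Proof.
move=> [f0 fd] [g0 gd]; split; first exact: cvgM.
move=> t t0; have fdt := fd t t0; have gdt := gd t t0.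
by apply: is_derive_eq; rewrite addrC /GRing.scale/= mulrC.
Qed.

Lemma smooth_from0Z (c : R) (f df : R -> R) : smooth_from0 f df ->
  smooth_from0 (fun t => c * f t) (fun t => c * df t).
Proof.
move=> /(smooth_from0M (smooth_from0_cst c)).
by congr smooth_from0; apply/funext => t; rewrite mul0r add0r.
Qed.

Lemma smooth_from0_sum (I : Type) (r : seq I) (P : pred I)
    (f df : I -> R -> R) :
  (forall i, P i -> smooth_from0 (f i) (df i)) ->
  smooth_from0 (fun t => \sum_(i <- r | P i) f i t)
               (fun t => \sum_(i <- r | P i) df i t).
Proof.
move=> fP; elim: r => [|i r IH].
  have := smooth_from0_cst 0; congr smooth_from0;
    by apply/funext => t; rewrite big_nil.
have [Pi|nPi] := boolP (P i).
  have := smooth_from0D (fP _ Pi) IH; congr smooth_from0;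
    by apply/funext => t; rewrite big_cons Pi.
by move: IH; congr smooth_from0; apply/funext => t; rewrite big_cons (negPf nPi).
Qed.

Lemma smooth_from0_prod (I : finType) (f df : I -> R -> R) :
  (forall i, smooth_from0 (f i) (df i)) ->
  smooth_from0 (fun t => \prod_i f i t)
               (fun t => \sum_i df i t * \prod_(j | j != i) f j t).
Proof.
move=> fP.
suff H (r : seq I) : uniq r -> smooth_from0 (fun t => \prod_(i <- r) f i t)
    (fun t => \sum_(i <- r) df i t * \prod_(j <- r | j != i) f j t).
  exact: (H _ (index_enum_uniq I)).
elim: r => [_|i r IH /= /andP[ir ur]].
  have := smooth_from0_cst 1; congr smooth_from0;
    by apply/funext => t; rewrite big_nil.
have := smooth_from0M (fP i) (IH ur); congr smooth_from0; apply/funext => t.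
  by rewrite big_cons.
rewrite big_cons big_cons eqxx/=; congr (_ * _ + _).
  rewrite big_seq [RHS]big_seq_cond; apply: eq_bigl => j; case jr: (j \in r) => //=.
  by apply/esym; apply: contraNneq ir => <-.
rewrite mulr_sumr big_seq [RHS]big_seq; apply: eq_bigr => j jr.
rewrite big_cons ifT; first by rewrite mulrCA.
by apply: contraNneq ir => ->.
Qed.

(* The hypothesis on [L] says that [L + Lam] is a positive operator of norm
   at most [Lam]: it holds for jump generators of total rate at most [Lam].
   Iterating on [expR (Lam * t) * w t] the lower bound [- C (Lam t)^k / k!]
   makes it vanish as [k] grows. *)
Lemma comparison (A : Type) (L : (A -> R) -> A -> R) (Lam C : R)
    (w dw : R -> A -> R) :
  0 <= Lam ->
  (forall (g : A -> R) (K : R) a, (forall b, - K <= g b) -> - (Lam * K) <= L g a + Lam * g a) ->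
  (forall a, smooth_from0 (w ^~ a) (dw ^~ a)) ->
  (forall (t : R) a, 0 < t -> L (w t) a <= dw t a) ->
  (forall (t : R) a, 0 <= t -> - C <= w t a) ->
  (forall a, 0 <= w 0 a) ->
  forall (t : R) a, 0 <= t -> 0 <= w t a.
Proof.
move=> Lam0 LP wS dwL wC w0 T a0 T0.
have e0 s : 0 < expR (Lam * s) := expR_gt0 _.
have [C0|C0] := leP C 0.
  by apply: le_trans (wC T a0 T0); rewrite oppr_ge0.
(* [C'] dominates [C * expR (Lam * t)] for every t up to T, which is the case k = 0 of the
   iteration. *)
pose C' := C * expR (Lam * T).
have dl (t : R) : is_derive t 1 ( *%R Lam) Lam.
  by apply: is_derive_eq; rewrite /GRing.scale/= mulr1.
have expS : smooth_from0 (fun t => expR (Lam * t)) (fun t => Lam * expR (Lam * t)).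
  apply: is_derive_smooth_from0 => t.
  have := is_derive1_comp (is_derive_expR (Lam * t)) (dl t).
  by rewrite mulrC.
pose b k (t : R) := C' * ((Lam * t) ^+ k / k`!%:R).
have bS k : smooth_from0 (b k.+1) (fun t => Lam * b k t).
  apply: is_derive_smooth_from0 => t.
  have := is_deriveZ (C' / k.+1`!%:R) (is_deriveX k.+1 (dl t)).
  congr (is_derive _ _ _ _).
    by apply/funext => s; rewrite /b /= exprfctE /GRing.scale/= mulrA mulrAC.
  rewrite /b factS natrM/= /GRing.scale/=.
  have k0 : (k.+1%:R : R) != 0 by rewrite pnatr_eq0.
  have k1 : (k`!%:R : R) != 0 by rewrite pnatr_eq0 -lt0n fact_gt0.
  by field; rewrite k1 addrC natr1.
have key k t a : 0 <= t -> t <= T -> - b k t <= expR (Lam * t) * w t a.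
  elim: k t a => [|k IH] t a t0 tT.
    rewrite /b expr0 fact0 divr1 mulr1 /C' -mulNr.
    apply: (@le_trans _ _ (- C * expR (Lam * t))).
      rewrite !mulNr lerN2 ler_pM2l// ler_expR ler_wpM2l//.
    by rewrite mulrC ler_pM2l// wC.
  have S := smooth_from0D (smooth_from0M expS (wS a)) (bS k).
  have := smooth_from0_le S t0.
  rewrite mulr0 expR0 mul1r [b k.+1 0]/b mulr0 expr0n/= mul0r mulr0 addr0.
  move=> H; rewrite -subr_ge0 opprK; apply: le_trans (w0 a) (H _) => s s0 st.
  (* The derivative of [expR (Lam * s) * w s a + b k.+1 s] is [expR (Lam * s) * (Lam * w s a + dw s
     a) + Lam * b k s]; the bound at level k and positivity of [L + Lam] make it nonnegative. *)
  have := LP (w s) ((expR (Lam * s))^-1 * b k s) a.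
  have wb c : - ((expR (Lam * s))^-1 * b k s) <= w s c.
    rewrite -mulrN ler_pdivrMl//; apply: IH; [exact: ltW|].
    by rewrite (le_trans (ltW st)).
  move=> /(_ wb) H1.
  have: - (Lam * ((expR (Lam * s))^-1 * b k s)) <= Lam * w s a + dw s a.
    by rewrite (le_trans H1)// addrC lerD2l dwL.
  rewrite -(ler_pM2l (e0 s)) -subr_ge0; congr (_ <= _).
  by field; rewrite gt_eqF.
suff : 0 <= expR (Lam * T) * w T a0 by rewrite pmulr_rge0.
have cb : b k T @[k --> \oo] --> 0.
  by rewrite -(mulr0 C'); apply: cvgM; [exact: cvg_cst|exact: cvg_exp_coeff].
have : (fun k => - b k T) @ \oo --> - (0 : R) by exact: cvgN.
rewrite oppr0 => /cvgr_to_le; apply.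
by apply: nearW => k; exact: key.
Qed.

End Comparison.

(** * Labelled particles *)

(** Several jumps [e] may lead to the same state, so a rate is a sum over the jumps with target [c].
    Regrouping by jumps turns the sum over states in [mt_backward] into a finite sum over [E]. *)
Lemma fsum_jumps (R : pzRingType) (A : choiceType) (I : eqType) (E : seq I)
    (m : I -> A) (r : I -> R) (G : A -> R) :
  \sum_(c \in [set: A]) (\sum_(e <- E | c == m e) r e) * G c =
  \sum_(e <- E) r e * G (m e).
Proof.
have [X XP] : exists X : {fset A}, forall e, e \in E -> m e \in X.
  by exists (seq_fset tt (map m E)) => e eE; rewrite seq_fsetE map_f.
rewrite (@fsbigTE _ _ _ _ X); last first.
  move=> c cX; rewrite big_seq_cond big1 ?mul0r// => e /andP[eE /eqP cE].
  by move: cX; rewrite cE XP.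
transitivity (\sum_(c <- X) \sum_(e <- E) if c == m e then r e * G (m e) else 0).
  apply: eq_bigr => c _; rewrite mulr_suml big_mkcond; apply: eq_bigr => e _.
  by case: eqP => // ->.
rewrite exchange_big/= big_seq [RHS]big_seq; apply: eq_bigr => e eE.
rewrite (big_fsetD1 (m e)) ?XP//= eqxx big1_fset ?addr0// => c.
by rewrite !inE => /andP[/negPf ->].
Qed.

Section LabelledParticles.
Context {R : realType} {S : site_space} (p : sites S -> sites S -> R).
Variable N : sites S -> {fset (sites S)}.
Hypothesis p_ge0 : forall x y, 0 <= p x y.
Hypothesis p_sym : forall x y, p x y = p y x.
Hypothesis p_diag : forall x, p x x = 0.
Hypothesis p_nbr : forall x y, y \notin N x -> p x y = 0.
Hypothesis p_sum1 : forall x, \sum_(y <- N x) p x y = 1.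

Definition relabel n (x : 'I_n -> sites S) (i : 'I_n) (y : sites S) :
  'I_n -> sites S := fun k => if k == i then y else x k.

Definition pile n (x : 'I_n -> sites S) : particles S :=
  seq_mset [seq x i | i <- enum 'I_n].

Lemma pileE n (x : 'I_n -> sites S) y : pile x y = (\sum_i (x i == y))%N.
Proof.
by rewrite mset_seqE -sumn_count sumn_map big_map big_enum; apply: eq_bigr.
Qed.

Lemma move_pile n (x : 'I_n -> sites S) i y :
  move (pile x) (x i) y = pile (relabel x i y).
Proof.
apply/msetP => z; rewrite /move mset1DE msetB1E !pileE.
rewrite (bigD1 i)//= [in RHS](bigD1 i)//= /relabel eqxx [z == y]eq_sym.
congr addn; rewrite [z == _]eq_sym addKn.
by apply: eq_bigr => j /negPf ->.
Qed.

Lemma big_pile n (x : 'I_n -> sites S) (h : sites S -> R) :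
  \sum_(a <- finsupp (pile x)) (pile x a)%:R * h a = \sum_i h (x i).
Proof.
transitivity (\sum_(a <- pile x) h a).
  rewrite big_mset; apply: eq_bigr => a _.
  by rewrite Monoid.iteropE mulr_natl; elim: (pile x a) => //= k <-; rewrite mulrS.
by rewrite (perm_big _ (perm_eq_seq_mset _)) big_map big_enum.
Qed.

Lemma p_le1 x y : p x y <= 1.
Proof.
have [yN|/p_nbr -> //] := boolP (y \in N x).
by rewrite -(p_sum1 x) (big_fsetD1 y)//= lerDl sumr_ge0.
Qed.

(* The SIP(1) generator on labelled configurations: independent walks at rate
   2p plus the attraction of each particle by each other one at rate 4p. *)
Definition labelled_gen n (F : ('I_n -> sites S) -> R) (x : 'I_n -> sites S) : R :=
  \sum_i \sum_(y <- N (x i)) 2 * p (x i) y * (F (relabel x i y) - F x) +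
  \sum_i \sum_j 4 * p (x i) (x j) * (F (relabel x i (x j)) - F x).

(** The walks have total rate 2n and the attraction has [n ^ 2] terms of rate at most 4, so [Lam]
    dominates the total jump rate. This is the positivity hypothesis of [comparison]. *)
Lemma labelled_gen_bound n (F : ('I_n -> sites S) -> R) (K : R) x :
  let Lam := 2 * n%:R + 4 * n%:R ^+ 2 in
  (forall y, - K <= F y) -> - (Lam * K) <= labelled_gen F x + Lam * F x.
Proof.
move=> Lam FK; rewrite /Lam.
have H (r : R) y : 0 <= r -> - (r * (F x + K)) <= r * (F y - F x).
  move=> r0; rewrite -mulrN ler_wpM2l// opprD addrC lerD2r; exact: FK.
have H1 : - (2 * n%:R * (F x + K)) <=
    \sum_i \sum_(y <- N (x i)) 2 * p (x i) y * (F (relabel x i y) - F x).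
  apply: (@le_trans _ _ (\sum_(i < n) - (2 * (F x + K)))).
    by rewrite sumr_const card_ord -mulr_natr; lra.
  apply: ler_sum => i _.
  have -> : 2 * (F x + K) = \sum_(y <- N (x i)) 2 * p (x i) y * (F x + K).
    by rewrite -mulr_suml -mulr_sumr p_sum1 mulr1.
  by rewrite -sumrN; apply: ler_sum => y _; rewrite H ?mulr_ge0.
have H2 : - (4 * n%:R ^+ 2 * (F x + K)) <=
    \sum_i \sum_j 4 * p (x i) (x j) * (F (relabel x i (x j)) - F x).
  apply: (@le_trans _ _ (\sum_(i < n) \sum_(j < n) - (4 * (F x + K)))).
    by rewrite !sumr_const card_ord -[_ *+ n *+ n]mulr_natr -mulr_natr; lra.
  apply: ler_sum => i _; apply: ler_sum => j _.
  apply: le_trans (H _ _ _); last by rewrite mulr_ge0.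
  rewrite lerN2 -mulrA ler_wpM2l// ler_piMl ?p_le1//.
  by have := FK x; lra.
rewrite /labelled_gen; nra.
Qed.

(** A move onto [b] leaves a particle at [b], so [b] lies in the support of the target [c]; and
    rates vanish outside [N a]. Both index sets thus give the same sum as their union. *)
Lemma sip_rateE (xi c : particles S) : sip_rate p xi c =
  \sum_(a <- finsupp xi) \sum_(b <- N a | c == move xi a b)
    p a b * (2 * xi a)%N%:R * (1 + 2 * xi b)%N%:R.
Proof.
apply: eq_bigr => a _.
pose U := (finsupp c `|` N a)%fset.
transitivity (\sum_(b <- U | c == move xi a b)
    p a b * (2 * xi a)%N%:R * (1 + 2 * xi b)%N%:R).
  rewrite big_mkcond [RHS]big_mkcond; apply: big_fset_incl => [|b _ nb].
    exact: fsubsetUl.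
  case: eqP => // ceq; move: nb; rewrite ceq msuppE in_mset.
  by rewrite /move mset1DE eqxx.
rewrite big_mkcond [RHS]big_mkcond; apply/esym; apply: big_fset_incl => [|b _ nb].
  exact: fsubsetUr.
by case: eqP => // _; rewrite p_nbr// !mul0r.
Qed.

(** The emission rate of a site is proportional to its number of particles, which amounts to one
    clock per label; the attraction factor [xi b] likewise counts the labels [j] sitting at [b]. *)
Lemma sip_gen_pile n (x : 'I_n -> sites S) (f : particles S -> R) :
  \sum_(c \in [set: particles S]) sip_rate p (pile x) c * (f c - f (pile x)) =
  labelled_gen (fun y => f (pile y)) x.
Proof.
pose xi := pile x; pose r a b := p a b * (2 * xi a)%N%:R * (1 + 2 * xi b)%N%:R.
transitivity (\sum_(a <- finsupp xi) \sum_(b <- N a) r a b * (f (move xi a b) - f xi)).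
  have := fsum_jumps [seq (a, b) | a <- finsupp xi, b <- N a]
    (fun e => move xi e.1 e.2) (fun e => r e.1 e.2) (fun c => f c - f xi).
  rewrite big_allpairs_dep/= => <-; apply: eq_fsbigr => c _.
  rewrite sip_rateE [in RHS]big_mkcond big_allpairs_dep/=; congr (_ * _).
  by apply: eq_bigr => a _; rewrite big_mkcond.
transitivity (\sum_(a <- finsupp xi) (xi a)%:R *
    \sum_(b <- N a) 2 * p a b * (1 + 2 * xi b)%N%:R * (f (move xi a b) - f xi)).
  apply: eq_bigr => a _; rewrite mulr_sumr; apply: eq_bigr => b _.
  by rewrite /r natrM; ring.
rewrite big_pile /labelled_gen -big_split/=; apply: eq_bigr => i _.
transitivity (\sum_(b <- N (x i)) 2 * p (x i) b * (f (move xi (x i) b) - f xi) +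
  \sum_(b <- N (x i)) \sum_j (if x j == b then
     4 * p (x i) (x j) * (f (move xi (x i) (x j)) - f xi) else 0)).
  rewrite -big_split/=; apply: eq_bigr => b _.
  transitivity (2 * p (x i) b * (f (move xi (x i) b) - f xi) +
      (xi b)%:R * (4 * p (x i) b * (f (move xi (x i) b) - f xi))).
    by rewrite natrD natrM; ring.
  congr (_ + _); rewrite [xi b]pileE natr_sum mulr_suml; apply: eq_bigr => j _.
  by case: eqP => [->|]; rewrite ?mul1r ?mul0r.
congr (_ + _); first by apply: eq_bigr => b _; rewrite move_pile.
rewrite exchange_big/=; apply: eq_bigr => j _.
have [jN|jN] := boolP (x j \in N (x i)).
  rewrite (big_fsetD1 (x j))//= eqxx big1_fset ?addr0 ?move_pile// => b.
  by rewrite !inE eq_sym => /andP[/negPf ->].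
rewrite p_nbr// mulr0 !mul0r big1_fset// => b bN _.
by case: eqP => // xb; move: jN; rewrite xb bN.
Qed.

(** Generator of the labelled SIP(1) pair; in the last term, the attraction, either particle joins
    the other at rate 4p. *)
Definition pair_gen (g : sites S * sites S -> R) (x y : sites S) : R :=
  \sum_(z <- N x) 2 * p x z * (g (z, y) - g (x, y)) +
  \sum_(z <- N y) 2 * p y z * (g (x, z) - g (x, y)) +
  4 * p x y * (g (x, x) + g (y, y) - 2 * g (x, y)).

Lemma sum_nbr_mem x y (h : sites S -> R) :
  \sum_(z <- N x) p x z * ((z == y)%:R * h z) = p x y * h y.
Proof.
have [yN|yN] := boolP (y \in N x).
  rewrite (big_fsetD1 y)//= eqxx mul1r big1_fset ?addr0// => z.
  by rewrite !inE => /andP[/negPf ->]; rewrite mul0r mulr0.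
rewrite p_nbr// mul0r big1_fset// => z zN _.
by case: eqP => [zy|]; rewrite ?mul0r ?mulr0//; move: yN; rewrite -zy zN.
Qed.

Lemma sip2_gen (g : sites S * sites S -> R) x y :
  \sum_(c \in [set: sites S * sites S]) sip2_rate p (x, y) c * (g c - g (x, y)) =
  pair_gen g x y.
Proof.
pose jump u z := 2 * p u z * (1 + 2 * ((z == x)%:R + (z == y)%:R)).
pose m (e : sites S + sites S) := match e with inl z => (z, y) | inr z => (x, z) end.
pose r (e : sites S + sites S) := match e with inl z => jump x z | inr z => jump y z end.
transitivity (\sum_(z <- N x) jump x z * (g (z, y) - g (x, y)) +
   \sum_(z <- N y) jump y z * (g (x, z) - g (x, y))).
  have := fsum_jumps (map inl (N x) ++ map inr (N y)) m r (fun c => g c - g (x, y)).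
  rewrite big_cat/= !big_map => <-; apply: eq_fsbigr => -[u v] _; congr (_ * _).
  rewrite big_cat/= !big_map /sip2_rate/= -!/(jump _ _); congr (_ + _).
  - transitivity (\sum_(z <- N x) p x z *
        ((z == u)%:R * ((y == v)%:R * (2 * (1 + 2 * ((z == x)%:R + (z == y)%:R)))))).
      by rewrite sum_nbr_mem /jump; ring.
    rewrite [RHS]big_mkcond; apply: eq_bigr => z _; rewrite /jump xpair_eqE.
    by rewrite [z == u]eq_sym [y == v]eq_sym; case: eqP; case: eqP => //= _ _; ring.
  - transitivity (\sum_(z <- N y) p y z *
        ((z == v)%:R * ((x == u)%:R * (2 * (1 + 2 * ((z == x)%:R + (z == y)%:R)))))).
      by rewrite sum_nbr_mem /jump; ring.
    rewrite [RHS]big_mkcond; apply: eq_bigr => z _; rewrite /jump xpair_eqE.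
    by rewrite [z == v]eq_sym [x == u]eq_sym; case: eqP; case: eqP => //= _ _; ring.
have split_jump a h : \sum_(z <- N a) jump a z * h z =
    \sum_(z <- N a) 2 * p a z * h z + 4 * (p a x * h x + p a y * h y).
  rewrite -!sum_nbr_mem -big_split mulr_sumr -big_split/=.
  by apply: eq_bigr => z _; rewrite /jump; ring.
by rewrite !split_jump /pair_gen !p_diag (p_sym y x); ring.
Qed.

End LabelledParticles.

Section SymmetricSums.
Variables (R : realType) (I : finType).

(** In the attraction terms a sign or a cancellation appears only once [i] jumping onto [j] is added
    to [j] jumping onto [i], so double sums over labels are handled in symmetrised form. *)
Lemma sum_sym (a : I -> I -> R) :
  2 * (\sum_i \sum_j a i j) = \sum_i \sum_j (a i j + a j i).
Proof.
rewrite mulr_natl mulr2n [in RHS](eq_bigr (fun i => \sum_j a i j + \sum_j a j i)).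
  by rewrite big_split/=; congr (_ + _); rewrite exchange_big.
by move=> i _; rewrite big_split.
Qed.

Lemma sum_sym_ge0 (a : I -> I -> R) :
  (forall i j, 0 <= a i j + a j i) -> 0 <= \sum_i \sum_j a i j.
Proof.
move=> a0; rewrite -(pmulr_rge0 _ (ltr0Sn R 1)) sum_sym.
by apply: sumr_ge0 => i _; apply: sumr_ge0.
Qed.

Lemma eq_sum_sym (a b : I -> I -> R) :
  (forall i j, a i j + a j i = b i j + b j i) ->
  \sum_i \sum_j a i j = \sum_i \sum_j b i j.
Proof.
move=> ab; apply: (mulfI (_ : 2 != 0 :> R)); first by rewrite pnatr_eq0.
by rewrite !sum_sym; apply: eq_bigr => i _; apply: eq_bigr => j _.
Qed.

End SymmetricSums.

(** * Sub- and supersolutions of the labelled equation *)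

Section LabelledComparison.
Context {R : realType} {S : site_space} (p : sites S -> sites S -> R).
Variable N : sites S -> {fset (sites S)}.
Hypothesis p_ge0 : forall x y, 0 <= p x y.
Hypothesis p_sym : forall x y, p x y = p y x.
Hypothesis p_diag : forall x, p x x = 0.
Hypothesis p_nbr : forall x y, y \notin N x -> p x y = 0.
Hypothesis p_sum1 : forall x, \sum_(y <- N x) p x y = 1.

Local Notation labelled_gen := (@labelled_gen R S p N _).
Local Notation pair_gen := (pair_gen p N).

Lemma labelled_genB n (F G : ('I_n -> sites S) -> R) x :
  labelled_gen (fun y => F y - G y) x = labelled_gen F x - labelled_gen G x.
Proof.
rewrite /labelled_gen [in RHS]opprD [in RHS]addrACA -!sumrB; congr (_ + _).
  by apply: eq_bigr => i _; rewrite -sumrB; apply: eq_bigr => y _; ring.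
by apply: eq_bigr => i _; rewrite -sumrB; apply: eq_bigr => y _; ring.
Qed.

Lemma labelled_gen0 n x : labelled_gen (fun _ : 'I_n -> sites S => 0) x = 0.
Proof.
by have := labelled_genB (fun=> 0) (fun=> 0) x; rewrite !subrr.
Qed.

Lemma labelled_gen_sum n (I : Type) (r : seq I) (c : I -> R)
    (F : I -> ('I_n -> sites S) -> R) x :
  labelled_gen (fun y => \sum_(k <- r) c k * F k y) x =
  \sum_(k <- r) c k * labelled_gen (F k) x.
Proof.
elim: r => [|k r IH].
  by rewrite big_nil -[RHS](labelled_gen0 x); congr labelled_gen; apply/funext => y; rewrite big_nil.
rewrite big_cons -IH /labelled_gen [in RHS]mulrDr [in RHS]addrACA; congr (_ + _).
  rewrite mulr_sumr -big_split/=; apply: eq_bigr => i _.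
  rewrite mulr_sumr -big_split/=; apply: eq_bigr => y _.
  by rewrite !big_cons/=; ring.
rewrite mulr_sumr -big_split/=; apply: eq_bigr => i _.
rewrite mulr_sumr -big_split/=; apply: eq_bigr => y _.
by rewrite !big_cons/=; ring.
Qed.

(** [comparison] for the difference of a supersolution [u] and a subsolution [v]; any constant [C]
    will do, as it only starts the iteration. *)
Lemma labelled_comparison n (C : R) (u v du dv : R -> ('I_n -> sites S) -> R) :
  (forall x, smooth_from0 (u ^~ x) (du ^~ x)) ->
  (forall x, smooth_from0 (v ^~ x) (dv ^~ x)) ->
  (forall (t : R) x, 0 < t -> labelled_gen (u t) x <= du t x) ->
  (forall (t : R) x, 0 < t -> dv t x <= labelled_gen (v t) x) ->
  (forall (t : R) x, 0 <= t -> v t x - u t x <= C) ->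
  (forall x, v 0 x <= u 0 x) ->
  forall (t : R) x, 0 <= t -> v t x <= u t x.
Proof.
move=> uS vS uL vL uvC uv0 t x t0; rewrite -subr_ge0.
pose Lam : R := 2 * n%:R + 4 * n%:R ^+ 2.
have := @comparison R _ labelled_gen Lam C (fun s y => u s y - v s y)
  (fun s y => du s y - dv s y).
apply => //.
- by rewrite addr_ge0// mulr_ge0// exprn_ge0.
- by move=> g K a; exact: labelled_gen_bound.
- move=> y; have := smooth_from0D (uS y) (smooth_from0Z (-1) (vS y)).
  by congr smooth_from0; apply/funext => s; rewrite mulN1r.
- by move=> s y s0; rewrite labelled_genB lerB ?uL ?vL.
- by move=> s y s0; rewrite lerNl opprB uvC.
- by move=> y; rewrite subr_ge0.
Qed.

(* The left-hand side is the generator of independent walks; the attraction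
   terms add [4 p(x_i, x_j) (h x_i - h x_j)^2] times the other factors for each
   pair of particles. *)
Lemma prod_subsolution n (h : sites S -> R) (x : 'I_n -> sites S) :
  (forall y, 0 <= h y) ->
  \sum_i (\sum_(y <- N (x i)) 2 * p (x i) y * (h y - h (x i))) *
    \prod_(j | j != i) h (x j) <= labelled_gen (fun y => \prod_i h (y i)) x.
Proof.
move=> h0; rewrite /labelled_gen.
have E i y : \prod_k h (relabel x i y k) - \prod_k h (x k) =
    (h y - h (x i)) * \prod_(j | j != i) h (x j).
  rewrite (bigD1 i)//= [X in _ - X](bigD1 i)//= {1}/relabel eqxx mulrBl.
  by congr (_ * _ - _); apply: eq_bigr => k /negPf ki; rewrite /relabel ki.
rewrite -[leLHS]addr0; apply: lerD.
  apply: ler_sum => i _; rewrite mulr_suml; apply: ler_sum => y _.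
  by rewrite E mulrA.
apply: sum_sym_ge0 => i j; rewrite !E.
have [->|ij] := eqVneq i j; first by rewrite p_diag !mulr0 !mul0r addr0.
rewrite (bigD1 j) 1?eq_sym//= [X in _ + _ * (_ * X)](bigD1 i)//=.
rewrite (p_sym (x j)); under [X in _ + _ * (_ * (_ * X))]eq_bigl do rewrite andbC.
set P := \prod_(k | _) _.
have P0 : 0 <= P by apply: prodr_ge0.
rewrite (_ : _ + _ = 4 * p (x i) (x j) * P * (h (x i) - h (x j)) ^+ 2); last by ring.
by rewrite mulr_ge0 ?sqr_ge0// mulr_ge0// mulr_ge0.
Qed.

(* Consistency of SIP(1): a uniformly chosen pair of the n particles evolves,
   on average, as two SIP(1) particles. *)
Lemma pair_sum_gen n (g : sites S * sites S -> R) (x : 'I_n -> sites S) :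
  labelled_gen (fun y => \sum_i \sum_(j | j != i) g (y i, y j)) x =
  \sum_i \sum_(j | j != i) pair_gen g (x i) (x j).
Proof.
(* The change in the two ordered pairs formed by [i] and [l] when particle [i] moves to [y]. *)
pose d i y l := g (y, x l) - g (x i, x l) + (g (x l, y) - g (x l, x i)).
have E i y : \sum_k \sum_(j | j != k) g (relabel x i y k, relabel x i y j) -
    \sum_k \sum_(j | j != k) g (x k, x j) = \sum_(l | l != i) d i y l.
  rewrite (bigD1 i)//= [X in _ - X](bigD1 i)//= {1}/relabel eqxx.
  rewrite opprD addrACA -!sumrB -big_split/=; apply: eq_bigr => l li.
  rewrite /d {1 2}/relabel (negPf li); congr (_ + _).
  rewrite (bigD1 i) 1?eq_sym//= [X in _ - X](bigD1 i) 1?eq_sym//=.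
  rewrite {1}/relabel eqxx opprD addrACA [X in _ + X](_ : _ = 0) ?addr0//.
  apply/eqP; rewrite subr_eq0; apply/eqP; apply: eq_bigr => k /andP[_ ki].
  by rewrite /relabel (negPf ki).
rewrite /labelled_gen /pair_gen.
under [RHS]eq_bigr do rewrite !big_split/=.
rewrite !big_split/=; congr (_ + _).
  under eq_bigr do under eq_bigr do rewrite E mulr_sumr.
  under eq_bigr do rewrite exchange_big/=.
  rewrite [X in _ = _ + X](exchange_big_dep predT)//= -big_split/=.
  apply: eq_bigr => i _; under [X in _ = _ + X]eq_bigl do rewrite eq_sym.
  rewrite -big_split/=; apply: eq_bigr => l _; rewrite -big_split/=.
  by apply: eq_bigr => y _; rewrite /d; ring.
under eq_bigr do under eq_bigr do rewrite E.
under [RHS]eq_bigr do rewrite big_mkcond/=.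
apply: eq_sum_sym => i j; rewrite [j == i]eq_sym.
have [->|ij] := eqVneq i j; first by rewrite p_diag/= !(mulr0, mul0r).
rewrite (bigD1 j) 1?eq_sym//= [X in _ + _ * X](bigD1 i)//=.
rewrite (p_sym (x j)); under [X in _ + _ * (_ + X)]eq_bigl do rewrite andbC.
(* For a third particle [k], the change when [j] jumps onto [i] is opposite to the change when [i]
   jumps onto [j]. The two rates are equal by symmetry of [p], so only the pair itself survives:
   this is why consistency holds. *)
rewrite [X in _ + _ * (_ + X)](_ : _ =
    - \sum_(k | (k != i) && (k != j)) d i (x j) k); last first.
  by rewrite -sumrN; apply: eq_bigr => k _; rewrite /d; ring.
by rewrite /d; ring.
Qed.

End LabelledComparison.

(** * Comparison of transition functions *)

Section Chains.
Context {R : realType}.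

Lemma mt_le1 (A : choiceType) (q : A -> A -> R) (P : R -> A -> A -> R) :
  markov_transition q P -> forall (t : R) a b, 0 <= t -> P t a b <= 1.
Proof.
move=> mP t a b t0; rewrite -lee_fin -(mt_sum1 mP a t0).
rewrite -[leLHS](@esum_set1 _ _ b (fun b => (P t a b)%:E)); last first.
  by rewrite lee_fin (mt_ge0 mP).
rewrite [leRHS](esumID [set b]) ?setTI; last first.
  by move=> c _; rewrite lee_fin (mt_ge0 mP).
by rewrite leeDl// esum_ge0// => c _; rewrite lee_fin (mt_ge0 mP).
Qed.

Lemma mt_smooth_from0 (A : choiceType) (q : A -> A -> R) (P : R -> A -> A -> R) :
  markov_transition q P -> forall a b, smooth_from0 (fun t => P t a b)
    (fun t => \sum_(c \in [set: A]) q a c * (P t c b - P t a b)).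
Proof.
move=> mP a b; split; first exact: mt_right_continuous mP a b.
by move=> t t0; have := mt_backward mP a b t0.
Qed.

Context {S : site_space} (p : sites S -> sites S -> R).
Variable N : sites S -> {fset (sites S)}.
Hypothesis p_ge0 : forall x y, 0 <= p x y.
Hypothesis p_sym : forall x y, p x y = p y x.
Hypothesis p_diag : forall x, p x x = 0.
Hypothesis p_nbr : forall x y, y \notin N x -> p x y = 0.
Hypothesis p_sum1 : forall x, \sum_(y <- N x) p x y = 1.
Variable P2 : R -> sites S * sites S -> sites S * sites S -> R.
Hypothesis P2_chain : markov_transition (sip2_rate p) P2.
Variable Q : R -> particles S -> particles S -> R.
Hypothesis Q_chain : markov_transition (sip_rate p) Q.

Local Notation labelled_gen := (@labelled_gen R S p N _).

(** The backward equation acts on the starting point, so a finite combination of transition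
    probabilities with fixed targets solves the labelled equation. *)
Lemma sip_smooth_from0 n (x : 'I_n -> sites S) (I : Type) (r : seq I)
    (c : I -> R) (m : I -> particles S) :
  smooth_from0 (fun t => \sum_(k <- r) c k * Q t (pile x) (m k))
    (fun t => labelled_gen (fun y => \sum_(k <- r) c k * Q t (pile y) (m k)) x).
Proof.
have := smooth_from0_sum r (P := predT)
  (fun k _ => smooth_from0Z (c k) (mt_smooth_from0 Q_chain (pile x) (m k))).
congr smooth_from0; apply/funext => t; rewrite labelled_gen_sum.
apply: eq_bigr => k _.
by rewrite (@sip_gen_pile _ _ p N p_nbr n x (fun xi => Q t xi (m k))).
Qed.

Lemma sip_sum_ge0 (t : R) (xi : particles S) (F : seq (particles S))
    (c : particles S -> R) : 0 <= t -> (forall xi, 0 <= c xi) ->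
  0 <= \sum_(xi' <- F) c xi' * Q t xi xi'.
Proof.
by move=> t0 c0; apply: sumr_ge0 => xi' _; rewrite mulr_ge0// (mt_ge0 Q_chain).
Qed.

Lemma sip_sum_le (t : R) (xi : particles S) (F : seq (particles S))
    (c : particles S -> R) : 0 <= t -> (forall xi, 0 <= c xi) ->
  \sum_(xi' <- F) c xi' * Q t xi xi' <= \sum_(xi' <- F) c xi'.
Proof.
move=> t0 c0; apply: ler_sum => xi' _.
by rewrite -[leRHS]mulr1 ler_wpM2l// (mt_le1 Q_chain).
Qed.

Lemma size_pile n (x : 'I_n -> sites S) : size (pile x) = n.
Proof. by rewrite (perm_size (perm_eq_seq_mset _)) size_map size_enum_ord. Qed.

Lemma mem_pile n (x : 'I_n -> sites S) y : y \in (pile x : seq _) <-> exists i, y = x i.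
Proof.
rewrite (perm_mem (perm_eq_seq_mset _)); split => [/mapP[i _ ->]|[i ->]]; first by exists i.
by rewrite map_f// mem_enum.
Qed.

(** This entry solves the n-label equation and vanishes at time 0, since a pile of n labels has size
    n; comparison with the zero solution keeps it nonpositive. *)
Lemma sip_conservation n (x : 'I_n -> sites S) (xi : particles S) (t : R) :
  0 <= t -> size xi != n -> Q t (pile x) xi = 0.
Proof.
move=> t0 xin; apply/le_anti/andP; split; last exact: (mt_ge0 Q_chain).
have E s y : \sum_(xi' <- [:: xi]) 1 * Q s (pile y) xi' = Q s (@pile _ n y) xi.
  by rewrite big_seq1 mul1r.
rewrite -E.
apply: (@labelled_comparison _ _ p N p_ge0 p_nbr p_sum1 n 1 (fun _ _ => 0)
  (fun s y => \sum_(xi' <- [:: xi]) 1 * Q s (pile y) xi')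
  (fun _ _ => 0) _ _ (fun y => sip_smooth_from0 y [:: xi] (fun=> 1) id)) => //.
- by move=> y; exact: smooth_from0_cst.
- by move=> s y s0; rewrite labelled_gen0.
- by move=> s y s0; rewrite E subr0 (mt_le1 Q_chain).
- move=> y; rewrite E (mt_start Q_chain); case: eqP => // yxi.
  by move: xin; rewrite -yxi size_pile eqxx.
Qed.

Lemma piles_of n (F0 : {fset (sites S)}) : exists F : {fset (particles S)},
  forall xi, xi \in F <->
    exists y : 'I_n -> sites S, (forall i, y i \in F0) /\ xi = pile y.
Proof.
exists (seq_fset tt [seq pile (fun i => val (f i)) | f : {ffun 'I_n -> F0}]) => xi.
rewrite seq_fsetE; split.
  by move=> /mapP[f _ ->]; exists (fun i => val (f i)); split=> // i; exact: valP.
move=> [y [yF ->]]; apply/mapP; exists [ffun i => [` yF i]%fset].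
  by rewrite mem_enum.
by congr pile; apply/funext => i; rewrite ffunE.
Qed.

(** A lone SIP(1) particle performs the walk of rates 2p, so [Q] on singletons serves as its
    transition function. This is h_t for [rho] restricted to [F0]. *)
Definition walk_mass (rho : sites S -> R) (F0 : {fset (sites S)}) (t : R)
    (y : sites S) : R :=
  \sum_(z <- F0) rho z * Q t [mset y]%mset [mset z]%mset.

Lemma pile1 (y : sites S) : pile (fun _ : 'I_1 => y) = [mset y]%mset.
Proof.
apply/msetP => z; rewrite pileE big_ord1 msetnE eq_sym.
by case: (z == y).
Qed.

Lemma walk_mass_smooth rho F0 y : smooth_from0 (fun t => walk_mass rho F0 t y)
  (fun t => \sum_(z <- N y) 2 * p y z * (walk_mass rho F0 t z - walk_mass rho F0 t y)).
Proof.
have := sip_smooth_from0 (fun _ : 'I_1 => y) F0 rho (fun z => [mset z]%mset).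
congr smooth_from0; apply/funext => t; rewrite ?pile1//.
(* A single label can only be attracted by itself, and [p y y = 0]. *)
rewrite /labelled_gen !big_ord1 p_diag mulr0 mul0r addr0.
apply: eq_bigr => z _; congr (_ * (_ - _)); last by rewrite pile1.
rewrite (_ : relabel _ _ _ = fun=> z) ?pile1//.
by apply/funext => i; rewrite /relabel (ord1 i) eqxx.
Qed.

Lemma walk_mass0 rho (F0 : {fset (sites S)}) y :
  walk_mass rho F0 0 y = (y \in F0)%:R * rho y.
Proof.
rewrite /walk_mass; under eq_bigr do rewrite (mt_start Q_chain).
have E z : ([mset y]%mset == [mset z]%mset :> particles S) = (y == z).
  by apply/eqP/eqP => [/msetP/(_ y)|->//]; rewrite !msetnE eqxx; case: eqP.
have [yF|yF] := boolP (y \in F0).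
  rewrite (big_fsetD1 y)//= eqxx mulr1 mul1r big1_fset ?addr0// => z.
  by rewrite E !inE eq_sym => /andP[/negPf ->]; rewrite mulr0.
rewrite mul0r big1_fset// => z zF _; rewrite E.
by case: eqP => [yz|]; rewrite ?mulr0//; move: yF; rewrite yz zF.
Qed.

Definition weight (rho : sites S -> R) (xi : particles S) : R :=
  \prod_(z <- xi) rho z.

Definition clash (xi : particles S) : R := (~~ uniq xi)%:R.

Lemma weight_pile n (rho : sites S -> R) (y : 'I_n -> sites S) :
  weight rho (pile y) = \prod_i rho (y i).
Proof. by rewrite /weight (perm_big _ (perm_eq_seq_mset _)) big_map big_enum. Qed.

Lemma clash_pile n (y : 'I_n -> sites S) : clash (pile y) = (~~ injectiveb y)%:R.
Proof. by rewrite /clash (perm_uniq (perm_eq_seq_mset _)). Qed.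

(* Liggett's inequality for the initial datum [rho] cut off outside [F0], which
   makes both sides finite sums of transition probabilities. *)
Lemma sip_ge_independent n (rho : sites S -> R) (F0 : {fset (sites S)})
    (F : {fset (particles S)}) (x : 'I_n -> sites S) (t : R) :
  (forall y, 0 <= rho y) ->
  (forall y : 'I_n -> sites S, (forall i, y i \in F0) -> pile y \in F) ->
  0 <= t ->
  \prod_i walk_mass rho F0 t (x i) <=
  \sum_(xi <- F) weight rho xi * Q t (pile x) xi.
Proof.
move=> rho0 FF t0.
have h0 s y : 0 <= s -> 0 <= walk_mass rho F0 s y.
  by move=> s0; apply: sumr_ge0 => z _; rewrite mulr_ge0// (mt_ge0 Q_chain).
pose C := \sum_(z <- F0) rho z.
have hC s y : 0 <= s -> walk_mass rho F0 s y <= C.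
  move=> s0; apply: ler_sum => z _.
  by rewrite -[leRHS]mulr1 ler_wpM2l// (mt_le1 Q_chain).
have c0 (xi : particles S) : 0 <= weight rho xi by exact: prodr_ge0.
apply: (@labelled_comparison _ _ p N p_ge0 p_nbr p_sum1 n (C ^+ n)
  (fun s y => \sum_(xi <- F) weight rho xi * Q s (pile y) xi)
  (fun s y => \prod_i walk_mass rho F0 s (y i))
  _ _ (fun y => sip_smooth_from0 y F (weight rho) id)
  (fun y => smooth_from0_prod (fun i => walk_mass_smooth rho F0 (y i)))) => //.
- by move=> s y s0; apply: prod_subsolution => // z; apply: h0; exact: ltW.
- move=> s y s0; apply: (@le_trans _ _ (\prod_i walk_mass rho F0 s (y i))).
    by rewrite gerBl sip_sum_ge0.
  rewrite -[n in C ^+ n]card_ord -prodr_const; apply: ler_prod => i _.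
  by rewrite h0//= hC.
- move=> y.
  (* Initially the product vanishes as soon as one label is outside [F0]; otherwise [pile y] is a
     target in [F], and its term alone equals the product. *)
  have [yF|/existsNP[i yF]] := pselect (forall i, y i \in F0); last first.
    rewrite (bigD1 i)//= walk_mass0 (negPf (introN idP yF)) !mul0r.
    exact: sip_sum_ge0.
  rewrite (big_fsetD1 (pile y))/= ?FF// (mt_start Q_chain) eqxx mulr1.
  rewrite weight_pile.
  rewrite (eq_bigr (fun i => rho (y i))); last by move=> i _; rewrite walk_mass0 yF mul1r.
  by rewrite lerDl sip_sum_ge0.
Qed.

Definition pair_meeting (F0 : {fset (sites S)}) (t : R) (xy : sites S * sites S) : R :=
  \sum_(z <- F0) P2 t xy (z, z).

Lemma pair_meeting_smooth F0 x y :
  smooth_from0 (fun t => pair_meeting F0 t (x, y))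
    (fun t => pair_gen p N (pair_meeting F0 t) x y).
Proof.
have := smooth_from0_sum F0 (P := predT)
  (fun z _ => mt_smooth_from0 P2_chain (x, y) (z, z)).
congr smooth_from0; apply/funext => t.
under eq_bigr => z _.
  rewrite (@sip2_gen _ _ p N p_sym p_diag p_nbr (fun c => P2 t c (z, z)))//.
  over.
rewrite /pair_gen /pair_meeting !big_split/=; congr (_ + _ + _).
- rewrite exchange_big/=; apply: eq_bigr => z _.
  by rewrite -mulr_sumr sumrB.
- rewrite exchange_big/=; apply: eq_bigr => z _.
  by rewrite -mulr_sumr sumrB.
- by rewrite -mulr_sumr sumrB big_split/= -mulr_sumr.
Qed.

(** By [pair_sum_gen] the sum over ordered pairs solves the n-label equation. At time 0 it is at
    least 1 at a coincidence whose pile is in [F], the shared site being in [F0] by hypothesis; so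
    it dominates [clash] from the start. *)
Lemma sip_coincidence n (F0 : {fset (sites S)}) (F : {fset (particles S)})
    (x : 'I_n -> sites S) (t : R) :
  (forall y : 'I_n -> sites S, pile y \in F -> forall i, y i \in F0) ->
  0 <= t ->
  \sum_(xi <- F) clash xi * Q t (pile x) xi <=
  \sum_i \sum_(j | j != i) pair_meeting F0 t (x i, x j).
Proof.
move=> FF t0.
have m0 s xy : 0 <= s -> 0 <= pair_meeting F0 s xy.
  by move=> s0; apply: sumr_ge0 => z _; rewrite (mt_ge0 P2_chain).
apply: (@labelled_comparison _ _ p N p_ge0 p_nbr p_sum1 n
  (\sum_(xi <- F) clash xi)
  (fun s y => \sum_i \sum_(j | j != i) pair_meeting F0 s (y i, y j))
  (fun s y => \sum_(xi <- F) clash xi * Q s (pile y) xi)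
  (fun s y => \sum_i \sum_(j | j != i) pair_gen p N (pair_meeting F0 s) (y i) (y j))
  _ _ (fun y => sip_smooth_from0 y F clash id)) => //.
- move=> y; apply: smooth_from0_sum => i _; apply: smooth_from0_sum => j _.
  exact: pair_meeting_smooth.
- by move=> s y s0; rewrite pair_sum_gen.
- move=> s y s0; apply: (@le_trans _ _ (\sum_(xi <- F) clash xi * Q s (pile y) xi)).
    by rewrite gerBl; apply: sumr_ge0 => i _; apply: sumr_ge0 => j _; exact: m0.
  exact: sip_sum_le.
- move=> y.
  have v0 : 0 <= \sum_i \sum_(j | j != i) pair_meeting F0 0 (y i, y j).
    by apply: sumr_ge0 => i _; apply: sumr_ge0 => j _; exact: m0.
  have [yF|yF] := boolP (pile y \in F); last first.
    rewrite big1_fset// => xi xiF _; rewrite (mt_start Q_chain).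
    by case: eqP => [yxi|]; rewrite ?mulr0//; move: yF; rewrite yxi xiF.
  rewrite (big_fsetD1 (pile y))//= (mt_start Q_chain) eqxx mulr1 big1_fset ?addr0; last first.
    move=> xi; rewrite !inE (mt_start Q_chain) eq_sym => /andP[/negPf -> _] _.
    by rewrite mulr0.
  rewrite clash_pile.
  have [//|/injectivePn[i [j ij yij]]] := boolP (injectiveb y).
  rewrite (bigD1 i)//= (bigD1 j) 1?eq_sym//= /pair_meeting yij.
  rewrite (big_fsetD1 (y j)) ?FF//= (mt_start P2_chain) eqxx -!addrA lerDl.
  rewrite addr_ge0//; first by apply: sumr_ge0 => z _; rewrite (mt_ge0 P2_chain).
  rewrite addr_ge0//; first by apply: sumr_ge0 => k _; rewrite m0.
  by apply: sumr_ge0 => k _; apply: sumr_ge0 => l _; rewrite m0.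
Qed.

End Chains.

(** * Moments of product measures and of the evolved law *)

Section Factor.
Context d (T : measurableType d) {R : realType}.
Variable nu : probability T R.
Local Open Scope ereal_scope.

Import HBNNSimple.

(** Passage from indicators to nonnegative [h]: linearity for simple functions, then monotone
    convergence. One coordinate [X] is split off, with [G] collecting the others. *)
Lemma integral_factor (X : T -> measurableTypeR R) (G : T -> R) (K : \bar R)
    (h : measurableTypeR R -> R) :
  measurable_fun [set: T] X -> measurable_fun [set: T] G ->
  (forall t, 0 <= G t)%R -> K \is a fin_num ->
  (forall C : set (measurableTypeR R), measurable C ->
     \int[nu]_t (\1_C (X t) * G t)%:E = nu (X @^-1` C) * K) ->
  measurable_fun [set: measurableTypeR R] h -> (forall r, 0 <= h r)%R ->
  \int[nu]_t (h (X t) * G t)%:E = (\int[nu]_t (h (X t))%:E) * K.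
Proof.
move=> mX mG G0 Kfin HK mh h0.
have K0 : 0 <= K.
  have := HK setT measurableT; rewrite preimage_setT probability_setT mul1e => <-.
  by apply: integral_ge0 => t _; rewrite lee_fin mulr_ge0.
have mXC C : measurable C -> measurable (X @^-1` C).
  by move=> mC; rewrite -[_ @^-1` _]setTI; exact: mX.
have nnsfunP (f : {nnsfun (measurableTypeR R) >-> R}) :
    \int[nu]_t (f (X t) * G t)%:E = (\int[nu]_t (f (X t))%:E) * K.
  have mi r : measurable_fun [set: T] (fun t => \1_(f @^-1` [set r]) (X t) : R).
    exact: measurableT_comp.
  have nn r t : (0 <= r * \1_(f @^-1` [set r]) t)%R.
    by rewrite -lee_fin EFinM nnfun_muleindic_ge0.
  have C1 (r : R) : range f r -> (0 <= r)%R by move=> [t _ <-].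
  transitivity (\sum_(r \in range f) \int[nu]_t (r * \1_(f @^-1` [set r]) (X t) * G t)%:E).
    rewrite -ge0_integral_fsum//.
    - apply: eq_integral => t _; rewrite fsumEFin// fimfunE.
      by rewrite !fsbig_finite//= mulr_suml.
    - move=> r; apply/measurable_EFinP; apply: measurable_funM => //.
      exact: measurable_funM.
    - by move=> r t _; rewrite lee_fin mulr_ge0.
  transitivity (\sum_(r \in range f) (r%:E * nu (X @^-1` (f @^-1` [set r]))) * K).
    apply: eq_fsbigr => r /set_mem/C1 r0.
    rewrite -muleA -HK// -ge0_integralZl//.
    - by apply: eq_integral => t _; rewrite -EFinM mulrA.
    - by apply/measurable_EFinP; exact: measurable_funM.
    - by move=> t _; rewrite lee_fin mulr_ge0.
  rewrite -ge0_mule_fsuml; last first.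
    move=> r; have [r0|r0] := leP 0%R r; first by rewrite mule_ge0.
    by rewrite preimage_nnfun0// preimage_set0 measure0 mule0.
  congr (_ * _).
  transitivity (\sum_(r \in range f) \int[nu]_t (r * \1_(f @^-1` [set r]) (X t))%:E).
    apply: eq_fsbigr => r /set_mem/C1 r0.
    under eq_integral do rewrite EFinM.
    rewrite ge0_integralZl//.
    - rewrite -[X in nu X]setIT -integral_indic//; last exact: mXC.
    - exact/measurable_EFinP.
  rewrite -ge0_integral_fsum//.
  - by apply: eq_integral => t _; rewrite fsumEFin// fimfunE.
  - by move=> r; apply/measurable_EFinP; exact: measurable_funM.
  - by move=> r t _; rewrite lee_fin.
have mh' : measurable_fun [set: measurableTypeR R] (EFin \o h) by exact/measurable_EFinP.
pose f_ := nnsfun_approx measurableT mh'.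
have fh r : (f_ n r)%:E @[n --> \oo] --> (h r)%:E.
  by apply: cvg_nnsfun_approx => // x _; rewrite lee_fin.
have fnd r m n : (m <= n)%N -> (f_ m r <= f_ n r)%R.
  by move=> mn; exact/lefP/nd_nnsfun_approx.
have mfX n : measurable_fun [set: T] (fun t => f_ n (X t)) by exact: measurableT_comp.
have L : \int[nu]_t (f_ n (X t) * G t)%:E @[n --> \oo] --> \int[nu]_t (h (X t) * G t)%:E.
  rewrite (eq_integral (fun t => limn (fun n => (f_ n (X t) * G t)%:E))); last first.
    move=> t _; apply/esym/cvg_lim => //; apply: cvg_EFin; first exact: nearW.
    by apply: cvgM; [exact: fine_cvg (fh (X t))|exact: cvg_cst].
  apply: cvg_monotone_convergence => //.
  - by move=> n; apply/measurable_EFinP; exact: measurable_funM.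
  - by move=> n t _; rewrite lee_fin mulr_ge0.
  - by move=> t _ m n mn; rewrite lee_fin ler_wpM2r// fnd.
have L' : (\int[nu]_t (f_ n (X t))%:E) @[n --> \oo] --> \int[nu]_t (h (X t))%:E.
  rewrite (eq_integral (fun t => limn (fun n => (f_ n (X t))%:E))); last first.
    by move=> t _; apply/esym/cvg_lim => //; exact: fh.
  apply: cvg_monotone_convergence => //.
  - by move=> n; apply/measurable_EFinP.
  - by move=> n t _; rewrite lee_fin.
  - by move=> t _ m n mn; rewrite lee_fin fnd.
have := cvgeZr Kfin L'; under eq_fun do rewrite -nnsfunP.
by move=> /(cvg_unique _ L) ->.
Qed.

End Factor.

Section Configurations.
Context {R : realType} {S : site_space}.
Local Notation X := (config R S).
Local Open Scope ereal_scope.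

Lemma measurable_eval (x : sites S) :
  measurable_fun [set: X] (fun eta : X => eta x : measurableTypeR R).
Proof.
move=> _ B mB; rewrite setTI; apply: sub_sigma_algebra.
by exists x, B.
Qed.

Lemma measurable_site (x : sites S) (C : set (measurableTypeR R)) :
  measurable C -> measurable [set eta : X | C (eta x)].
Proof. by move=> mC; have := @measurable_eval x measurableT C mC; rewrite setTI. Qed.

Lemma measurable_D (xi : particles S) :
  measurable_fun [set: X] (fun eta : X => (D xi eta)%:E).
Proof.
apply/measurable_EFinP; apply: measurable_prod => x _.
apply: measurable_funM; last exact: measurable_cst.
by apply: measurable_funX; exact: measurable_eval.
Qed.

Lemma D_ge0 (xi : particles S) (eta : sites S -> R) : (0 <= D xi eta)%R.
Proof.
by apply: prodr_ge0 => x _; rewrite mulr_ge0 ?invr_ge0// exprM exprn_ge0 ?sqr_ge0.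
Qed.

Lemma D_uniq (xi : particles S) (eta : sites S -> R) : uniq xi ->
  D xi eta = (\prod_(x <- xi) eta x ^+ 2)%R.
Proof.
move=> u; have p : perm_eq xi (finsupp xi).
  by rewrite -[X in perm_eq X]undup_id// perm_undup_mset.
rewrite [RHS](perm_big _ p) /D; apply: eq_big_seq => x.
rewrite -(perm_mem p) => xxi.
have -> : xi x = 1%N by rewrite -count_mem_mset count_uniq_mem// xxi.
by rewrite /odd_fact big_ord1 muln0 add0n divr1.
Qed.

Variable nu : probability X R.
Hypothesis nu_product : product_measure nu.

Lemma product_cylinders (s : seq (sites S)) (A : sites S -> set (measurableTypeR R)) :
  uniq s -> (forall x, measurable (A x)) ->
  \int[nu]_eta (\prod_(x <- s) \1_(A x) (eta x))%:E =
  \prod_(x <- s) nu [set eta : X | A x (eta x)].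
Proof.
move=> us mA; have [m mP] := nu_product.
have m1 x : nu [set eta : X | A x (eta x)] = m x (A x).
  have := mP [fset x]%fset A mA; rewrite big_seq_fset1 => <-.
  by congr (nu _); apply/seteqP; split=> eta /= H; [by move=> y; rewrite inE => /eqP ->|by apply: H; rewrite inE].
have [F ps] : exists F : {fset (sites S)}, perm_eq F s.
  by exists [fset x in s]%fset; rewrite uniq_perm// => x; rewrite !inE.
rewrite -(perm_big _ ps) (eq_bigr (fun x => m x (A x))); last by move=> x _; exact: m1.
rewrite -mP//; under eq_integral do rewrite -(perm_big _ ps).
have -> : [set eta : X | forall x, x \in F -> A x (eta x)] =
    \bigcap_(x in [set` F]) [set eta : X | A x (eta x)] by [].
rewrite -[X in nu X]setIT -integral_indic//; last first.
  apply: fin_bigcap_measurable => // x _.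
  exact: measurable_site.
apply: eq_integral => eta _; congr EFin; rewrite indicE.
have [/mem_set Aeta|nA] := pselect ((\bigcap_(x in [set` F]) [set eta : X | A x (eta x)]) eta).
  rewrite Aeta big1_fset// => x xF _; rewrite indicE mem_set//.
  by move/set_mem: Aeta; exact.
rewrite memNset//; have [x [xF nAx]] : exists x, x \in F /\ ~ A x (eta x).
  apply: contrapT => H; apply: nA => x xF; apply: contrapT => nAx.
  by apply: H; exists x.
by rewrite (big_fsetD1 x)//= indicE memNset// mul0r.
Qed.

(** The indicators serve the induction: the claim for [s1] and [x :: s2] is the factorisation over
    sets that [integral_factor] requires before [h (eta x)] can be split off. *)
Lemma product_moments (h : measurableTypeR R -> R) (s1 s2 : seq (sites S))
    (A : sites S -> set (measurableTypeR R)) :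
  measurable_fun setT h -> (forall r, 0 <= h r)%R ->
  (forall x, \int[nu]_eta (h (eta x))%:E \is a fin_num) ->
  uniq (s1 ++ s2) -> (forall x, measurable (A x)) ->
  \int[nu]_eta ((\prod_(x <- s1) h (eta x)) *
    \prod_(x <- s2) \1_(A x) (eta x))%:E =
  (\prod_(x <- s1) \int[nu]_eta (h (eta x))%:E) *
    \prod_(x <- s2) nu [set eta : X | A x (eta x)].
Proof.
move=> mh h0 hfin; elim: s1 s2 A => [|x s1 IH] s2 A us mA.
  rewrite big_nil mul1e -product_cylinders//.
  by apply: eq_integral => eta _; rewrite big_nil mul1r.
pose G (eta : X) := ((\prod_(x <- s1) h (eta x)) * \prod_(x <- s2) \1_(A x) (eta x))%R.
rewrite big_cons -muleA.
have G0 eta : (0 <= G eta)%R by rewrite mulr_ge0// prodr_ge0.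
have mG : measurable_fun [set: X] G.
  apply: measurable_funM; apply: measurable_prod => y _.
    by apply: (measurableT_comp mh); exact: measurable_eval.
  have := @measurable_indic _ _ R setT _ (mA y).
  by move=> /measurableT_comp; apply; exact: measurable_eval.
rewrite -(integral_factor (measurable_eval x) mG G0)//.
- by apply: eq_integral => eta _; rewrite big_cons mulrA.
- rewrite fin_numM// prode_fin_num// => y _; rewrite fin_num_measure//.
  exact: measurable_site.
(* [A'] changes [A] at [x] only; as [x] is not in [s2], the other indicators stay the same. *)
- move=> C mC; pose A' y := if y == x then C else A y.
  have mA' y : measurable (A' y) by rewrite /A'; case: ifP.
  have := IH (x :: s2) A'.
  have xs2 : x \notin s2.
    by move: us; rewrite /= mem_cat negb_or => /andP[/andP[]].
  have E (Y : Type) (f : sites S -> set (measurableTypeR R) -> Y) op (idx : Y) :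
      \big[op/idx]_(y <- s2) f y (A' y) = \big[op/idx]_(y <- s2) f y (A y).
    apply: eq_big_seq => y ys2; rewrite /A' ifF//.
    by apply: contraNF xs2 => /eqP <-.
  rewrite !big_cons (E _ (fun y C => nu [set eta : X | C (eta y)])).
  have A'x : A' x = C by rewrite /A' eqxx.
  rewrite A'x => H; rewrite muleCA -H//.
  + apply: eq_integral => eta _; rewrite /G big_cons.
    rewrite (E _ (fun y C => \1_C (eta y))) A'x; congr EFin; ring.
  + by move: us; rewrite -[X in uniq X]/([:: x] ++ s1 ++ s2) uniq_catCA.
Qed.

Lemma integral_D_uniq (xi : particles S) :
  (forall x, \int[nu]_eta (eta x ^+ 2)%:E \is a fin_num) -> uniq xi ->
  \int[nu]_eta (D xi eta)%:E = \prod_(x <- xi) \int[nu]_eta (eta x ^+ 2)%:E.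
Proof.
move=> fin u.
have mh : measurable_fun [set: measurableTypeR R] (fun r : measurableTypeR R => r ^+ 2 : R)%R.
  exact: measurable_funX.
have := @product_moments _ xi [::] (fun=> setT) mh (fun r => sqr_ge0 r) fin.
rewrite big_nil mule1 cats0 => <-//.
by apply: eq_integral => eta _; rewrite big_nil mulr1 D_uniq.
Qed.

End Configurations.

(** * Interchange of sums and integrals, and duality integrated against the initial law *)

Section EsumSwap.
Context d (X : measurableType d) {R : realType}.
Local Open Scope ereal_scope.

(** Through [e] the sum becomes a series over the naturals with zeros off the range of [e], and
    nonnegative series commute with the integral. *)
Lemma integral_esum (mu : {measure set X -> \bar R}) (T : choiceType) (e : T -> nat)
    (f : T -> X -> \bar R) : injective e ->
  (forall i, measurable_fun [set: X] (f i)) -> (forall i x, 0 <= f i x) ->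
  measurable_fun [set: X] (fun x => \esum_(i in [set: T]) f i x) /\
  \int[mu]_x (\esum_(i in [set: T]) f i x) = \esum_(i in [set: T]) \int[mu]_x f i x.
Proof.
move=> einj mf f0.
pose g (n : nat) : option T :=
  if pselect (exists i, e i = n) is left H then Some (projT1 (cid H)) else None.
have eK i : g (e i) = Some i.
  rewrite /g; case: pselect => [H|[]]; last by exists i.
  by case: cid => j /= /einj ->.
pose b (a : T -> \bar R) (n : nat) := if g n is Some i then a i else 0.
have b0 a : (forall i, 0 <= a i) -> forall n, 0 <= b a n.
  by move=> a0 n; rewrite /b; case: (g n).
have bE a : (forall i, 0 <= a i) -> \esum_(i in [set: T]) a i = \sum_(n <oo) b a n.
  move=> a0; rewrite nneseries_esumT; last exact: b0.
  transitivity (\esum_(n in e @` [set: T]) b a n).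
    rewrite esum_image; last by move=> i j _ _; exact: einj.
    by apply: eq_esum => i _; rewrite /b eK.
  rewrite esum_mkcond; apply: eq_esum => n _; case: ifPn => // /negP nT.
  rewrite /b /g; case: pselect => // -[i ein]; exfalso; apply: nT.
  by apply/mem_set; exists i.
have bf n : (fun x => b (fun i => f i x) n) =
    (if g n is Some i then f i else cst 0) by apply/funext => x; rewrite /b; case: (g n).
have mb n : measurable_fun [set: X] (fun x => b (fun i => f i x) n).
  by rewrite bf; case: (g n) => [i|]; [exact: mf|exact: measurable_cst].
have E : (fun x => \esum_(i in [set: T]) f i x) = (fun x => \sum_(n <oo) b (fun i => f i x) n).
  by apply/funext => x; rewrite bE.
split.
  rewrite E; apply: ge0_emeasurable_sum => //.
  by move=> n x _ _; exact: b0.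
rewrite bE; last by move=> i; apply: integral_ge0 => x _.
rewrite E integral_nneseries//; last by move=> n x _; exact: b0.
apply: eq_eseriesr => n _; rewrite bf /b; case: (g n) => //.
exact: integral0.
Qed.

End EsumSwap.

Section Evolution.
Context {R : realType} {S : site_space}.
Local Notation X := (config R S).
Local Open Scope ereal_scope.

(** [evolve nu P] is the composition of the constant kernel [nu] on [unit] with [P], so the integral
    formula for composed kernels applies. *)
Lemma integral_evolve (nu : probability X R) (P : R.-pker X ~> X) (f : X -> \bar R) :
  measurable_fun [set: X] f -> (forall x, 0 <= f x) ->
  \int[evolve nu P]_x f x = \int[nu]_eta \int[P eta]_x f x.
Proof.
move=> mf f0.
have := @integral_kcomp _ _ _ unit X X R
  (kprobability (measurable_cst (nu : pprobability X R))) (kernel.kernel_snd P) tt f f0 mf.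
move=> <-; apply: eq_measure_integral => A mA _ /=.
by [].
Qed.

Lemma particles_embed : exists e : particles S -> nat, injective e.
Proof.
exists (fun xi => choice.pickle (multiset.enum_mset xi)) => xi xi'.
move=> /(pcan_inj choice.pickleK) E.
by rewrite -(seq_mset_id xi) E seq_mset_id.
Qed.

(** [G] is a set of full measure on which duality is known, later the tempered configurations;
    nonnegativity lets the sum leave the integral. *)
Lemma moment_evolve (nu : probability X R) (B : R.-pker X ~> X)
    (G : set X) (q : particles S -> R) (xi : particles S) :
  (forall xi', (0 <= q xi')%R) ->
  {ae nu, forall eta, G eta} ->
  (forall eta : X, G eta -> \int[B eta]_zeta (D xi zeta)%:E =
    \esum_(xi' in [set: particles S]) (q xi' * D xi' eta)%:E) ->
  \int[evolve nu B]_eta (D xi eta)%:E =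
  \esum_(xi' in [set: particles S]) ((q xi')%:E * \int[nu]_eta (D xi' eta)%:E).
Proof.
move=> q0 aeG dual; rewrite integral_evolve; [|exact: measurable_D|by move=> x; rewrite lee_fin D_ge0].
have [e einj] := particles_embed.
have qD0 xi' (eta : X) : 0 <= (q xi' * D xi' eta)%:E by rewrite lee_fin mulr_ge0// D_ge0.
have [mE intE] := @integral_esum _ X R nu _ e
  (fun xi' eta => (q xi' * D xi' eta)%:E) einj
  (fun xi' => measurable_funeM (q xi')%:E (@measurable_D R S xi')) qD0.
rewrite (ge0_ae_eq_integral measurableT _ mE).
- rewrite intE; apply: eq_esum => xi' _; rewrite -ge0_integralZl//.
  + exact: measurable_D.
  + by move=> eta _; rewrite lee_fin D_ge0.
  + by rewrite lee_fin.
- apply: measurable_fun_integral_kernel; last exact: measurable_D.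
  + by move=> U mU; exact: measurable_kernel.
  + by move=> z; rewrite lee_fin D_ge0.
- by move=> eta _; apply: integral_ge0 => z _; rewrite lee_fin D_ge0.
- by move=> eta _; apply: esum_ge0 => z _; exact: qD0.
- by apply: filterS aeG => eta Geta _; exact: dual.
Qed.

End Evolution.

Lemma esum_exhaust {R : realType} (T : choiceType) (a : T -> R) (F : nat -> {fset T}) :
  (forall i, 0 <= a i) ->
  {homo F : i j / (i <= j)%N >-> (i `<=` j)%fset} ->
  (forall F0 : {fset T}, exists k, (F0 `<=` F k)%fset) ->
  (exists C : R, \esum_(i in [set: T]) (a i)%:E <= C%:E)%E ->
  \esum_(i in [set: T]) (a i)%:E \is a fin_num /\
  \sum_(i <- F k) a i @[k --> \oo] --> fine (\esum_(i in [set: T]) (a i)%:E).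
Proof.
move=> a0 Fmono Fall [C EC]; set s := esum _ _.
have a0' i : (0 <= (a i)%:E)%E by rewrite lee_fin.
have sfin : s \is a fin_num.
  rewrite ge0_fin_numE; first exact: le_lt_trans EC (ltry _).
  by apply: esum_ge0 => i _; exact: a0'.
have leF (F0 : {fset T}) : ((\sum_(i <- F0) a i)%:E <= s)%E.
  apply: ereal_sup_ubound; exists [set` F0]; first by split=> //; exact: finite_fset.
  by rewrite fsbig_finite//= set_fsetK sumEFin.
have mono (F0 F1 : {fset T}) : (F0 `<=` F1)%fset -> \sum_(i <- F0) a i <= \sum_(i <- F1) a i.
  move=> F01; rewrite -lee_fin -!sumEFin.
  by apply: lee_sum_nneg_subfset; [exact: fsubsetP|move=> i _ _; exact: a0'].
split=> //.
suff : (\sum_(i <- F k) a i)%:E @[k --> \oo] --> (fine s)%:E by move=> /fine_cvg.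
rewrite fineK//.
have nd : nondecreasing_seq (fun k => (\sum_(i <- F k) a i)%:E).
  by move=> i j ij; rewrite lee_fin mono// Fmono.
suff -> : s = ereal_sup (range (fun k => (\sum_(i <- F k) a i)%:E)).
  exact: ereal_nondecreasing_cvgn.
apply/eqP; rewrite eq_le; apply/andP; split; last first.
  by apply: ge_ereal_sup => _ [k _ <-].
apply: ge_ereal_sup => _ [A [Afin _] <-]; rewrite fsbig_finite//= sumEFin.
have [k Ak] := Fall (fset_set A).
apply: le_trans (ereal_sup_ubound _); last by exists k.
by rewrite lee_fin mono.
Qed.

(** * Bounds for the dual moments *)

Section MomentBounds.
Context {R : realType} {S : site_space} (p : sites S -> sites S -> R).
Variable N : sites S -> {fset (sites S)}.
Hypothesis p_ge0 : forall x y, 0 <= p x y.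
Hypothesis p_sym : forall x y, p x y = p y x.
Hypothesis p_diag : forall x, p x x = 0.
Hypothesis p_nbr : forall x y, y \notin N x -> p x y = 0.
Hypothesis p_sum1 : forall x, \sum_(y <- N x) p x y = 1.
Variable P2 : R -> sites S * sites S -> sites S * sites S -> R.
Hypothesis P2_chain : markov_transition (sip2_rate p) P2.
Variable Q : R -> particles S -> particles S -> R.
Hypothesis Q_chain : markov_transition (sip_rate p) Q.
Variables (M : particles S -> \bar R) (rho : sites S -> R) (r : R).
Hypothesis M_ge0 : forall xi : particles S, (0 <= M xi)%E.
Hypothesis M_uniq : forall xi : particles S, uniq xi -> M xi = (weight rho xi)%:E.
Hypothesis rho_ge0 : forall x, 0 <= rho x.
Hypothesis r_ge0 : 0 <= r.
Hypothesis rho_le : forall x, rho x <= r.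

Definition sip_moment (t : R) (xi : particles S) : \bar R :=
  \esum_(xi' in [set: particles S]) ((Q t xi xi')%:E * M xi')%E.

Lemma sip_moment_ge (F : {fset (particles S)}) (t : R) xi : 0 <= t ->
  (\sum_(xi' <- F) (Q t xi xi')%:E * M xi' <= sip_moment t xi)%E.
Proof.
move=> t0; apply: ereal_sup_ubound; exists [set` F].
  by split=> //; exact: finite_fset.
by rewrite fsbig_finite//= set_fsetK.
Qed.

(** The product comes from [sip_ge_independent]. The subtracted term pays for coincidences: a weight
    is at most [r ^+ n], and [sip_coincidence] charges at most [e] to each of at most [n ^ 2]
    ordered pairs. *)
Lemma sip_moment_lower n (x : 'I_n -> sites S) (F0 : {fset (sites S)}) (t e : R) :
  0 <= t -> 0 <= e ->
  (ereal_sup [set \esum_(z in [set: sites S]) (P2 t xy (z, z))%:E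
    | xy in [set: sites S * sites S]] <= e%:E)%E ->
  ((\prod_i walk_mass Q rho F0 t (x i) - r ^+ n * (n%:R ^+ 2 * e))%:E <=
    sip_moment t (pile x))%E.
Proof.
move=> t0 e0 supe; have [F FP] := piles_of n F0.
have Q0 xi xi' : 0 <= Q t xi xi' by rewrite (mt_ge0 Q_chain).
have w0 xi : 0 <= weight rho xi by exact: prodr_ge0.
(* At a coincidence the left-hand side is 0 and only [0 <= M xi] is used. *)
have Mc (xi : particles S) : ((weight rho xi * (1 - clash xi))%:E <= M xi)%E.
  rewrite /clash; have [u|_] := boolP (uniq xi); first by rewrite M_uniq//= subr0 mulr1.
  by rewrite subrr mulr0.
apply: le_trans (sip_moment_ge F _ t0).
have meet xy : pair_meeting P2 F0 t xy <= e.
  rewrite -lee_fin -sumEFin; apply: le_trans supe.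
  apply: le_trans (ereal_sup_ubound _); last by exists xy.
  apply: ereal_sup_ubound; exists [set` F0].
    by split=> //; exact: finite_fset.
  by rewrite fsbig_finite//= set_fsetK.
have clash_le : \sum_(xi <- F) clash xi * Q t (pile x) xi <= n%:R ^+ 2 * e.
  apply: (@le_trans _ _ (\sum_i \sum_(j | j != i) pair_meeting P2 F0 t (x i, x j))).
    apply: (sip_coincidence p_ge0 p_sym p_diag p_nbr p_sum1 P2_chain Q_chain) => //.
    move=> y /FP[z [zF0 yz]] i.
    have : y i \in (pile y : seq _) by rewrite mem_pile; exists i.
    by rewrite yz mem_pile => -[j ->].
  apply: (@le_trans _ _ (\sum_(i < n) \sum_(j < n) e)).
    apply: ler_sum => i _; rewrite big_mkcond; apply: ler_sum => j _.
    by case: ifP.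
  by rewrite !sumr_const card_ord -[_ *+ n *+ n]mulr_natr -[e *+ n]mulr_natr; lra.
apply: (@le_trans _ _ (\sum_(xi <- F) (Q t (pile x) xi * (weight rho xi * (1 - clash xi))))%:E).
  rewrite lee_fin.
  apply: (@le_trans _ _ (\sum_(xi <- F) weight rho xi * Q t (pile x) xi -
     r ^+ n * \sum_(xi <- F) clash xi * Q t (pile x) xi)).
    apply: lerB; last first.
      by rewrite ler_wpM2l// exprn_ge0.
    apply: (sip_ge_independent p_ge0 p_sym p_diag p_nbr p_sum1 Q_chain) => // y yF.
    by apply/FP; exists y.
  rewrite mulr_sumr -sumrB big_seq [leRHS]big_seq; apply: ler_sum => xi /FP[y [_ ->]].
  have wr : weight rho (pile y) <= r ^+ n.
    rewrite weight_pile -[n in r ^+ n]card_ord -prodr_const; apply: ler_prod => i _.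
    by rewrite rho_ge0 rho_le.
  have c0 : 0 <= clash (R := R) (pile y) by rewrite /clash.
  rewrite -subr_ge0 in wr.
  have := mulr_ge0 (mulr_ge0 c0 (Q0 (pile x) (pile y))) wr; lra.
rewrite -sumEFin; apply: lee_sum => xi _; rewrite EFinM.
by rewrite lee_wpmul2l ?lee_fin.
Qed.

Lemma size1_mset (xi : particles S) : size xi = 1%N -> exists z, xi = [mset z]%mset.
Proof.
move=> xi1; rewrite -(seq_mset_id xi); case: (enum_mset xi) xi1 => [|z []]// _; exists z.
by apply/msetP => y; rewrite mset_seqE msetnE/= addn0 eq_sym; case: eqP.
Qed.

(** By conservation a single particle stays on singletons, where [M] is [rho]. The moment is then a
    sum over sites, at most [r] because the mass is at most 1, and [walk_mass] gives its partial
    sums. *)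
Lemma sip_moment1 (F : nat -> {fset (sites S)}) (x : sites S) (t : R) :
  {homo F : i j / (i <= j)%N >-> (i `<=` j)%fset} ->
  (forall F0 : {fset (sites S)}, exists k, (F0 `<=` F k)%fset) ->
  0 <= t ->
  (sip_moment t [mset x]%mset <= r%:E)%E /\
  sip_moment t [mset x]%mset \is a fin_num /\
  walk_mass Q rho (F k) t x @[k --> \oo] --> fine (sip_moment t [mset x]%mset).
Proof.
move=> Fmono Fall t0.
pose q xi := Q t [mset x]%mset xi.
have q0 xi : 0 <= q xi by rewrite /q (mt_ge0 Q_chain).
have q1 (xi : particles S) : size xi != 1%N -> q xi = 0.
  by rewrite /q -pile1 => xi1; rewrite (sip_conservation p_ge0 p_nbr p_sum1 Q_chain).
have M1 z : M [mset z]%mset = (rho z)%:E.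
  by rewrite M_uniq /weight enum_msetn//= big_seq1.
have E : sip_moment t [mset x]%mset = \esum_(z in [set: sites S]) (rho z * q [mset z]%mset)%:E.
  transitivity (\esum_(xi in (fun z => [mset z]%mset : particles S) @` [set: sites S])
      ((q xi)%:E * M xi)%E).
    rewrite [RHS]esum_mkcond; apply: eq_esum => xi _; case: ifPn => // /negP xiN.
    rewrite -/(q _) q1 ?mul0e//; apply: contra_notN xiN => /eqP xi1; apply/mem_set.
    by have [z ->] := size1_mset xi1; exists z.
  rewrite esum_image; first by apply: eq_esum => z _; rewrite M1 -EFinM mulrC.
  by move=> y z _ _ /msetP/(_ y); rewrite !msetnE eqxx; case: eqP.
have Er : (sip_moment t [mset x]%mset <= r%:E)%E.
  rewrite E; apply: ge_ereal_sup => _ [A [Afin _] <-].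
  have QA : \sum_(z <- fset_set A) q [mset z]%mset <= 1.
    have inj : injective (fun z => [mset z]%mset : particles S).
      by move=> y z /msetP/(_ y); rewrite !msetnE eqxx; case: eqP.
    pose A' := [fset ([mset z]%mset : particles S) | z in fset_set A]%fset.
    have -> : \sum_(z <- fset_set A) q [mset z]%mset = \sum_(xi <- A') q xi.
      by rewrite big_imfset//= => y z _ _; exact: inj.
    rewrite -lee_fin -sumEFin -(mt_sum1 Q_chain [mset x]%mset t0).
    apply: ereal_sup_ubound; exists [set` A']; first by split=> //; exact: finite_fset.
    by rewrite fsbig_finite//= set_fsetK.
  rewrite fsbig_finite//= sumEFin lee_fin.
  apply: (@le_trans _ _ (\sum_(z <- fset_set A) r * q [mset z]%mset)).
    by apply: ler_sum => z _; rewrite ler_wpM2r.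
  by rewrite -mulr_sumr ler_piMr.
split=> //; rewrite E; apply: esum_exhaust => //; last by exists r; rewrite -E.
by move=> z; rewrite mulr_ge0.
Qed.

End MomentBounds.

(** * Temperedness of the initial law *)

Section LatticeBall.
Variable d : nat.

(** The shift by r turns 0, ..., 2r into the coordinates allowed in the ball; the box makes
    [lattice_ball] finite and bounds its cardinality. *)
Definition lattice_box (r : nat) : seq 'rV[int]_d :=
  [seq (\row_j ((f j : nat)%:Z - r%:Z))%R | f : {ffun 'I_d -> 'I_(2 * r + 1)}].

Definition lattice_ball (r : nat) : {fset 'rV[int]_d} :=
  [fset x in lattice_box r | (site_norm x <= r)%N]%fset.

Lemma mem_lattice_ball r (x : 'rV[int]_d) : (x \in lattice_ball r) = (site_norm x <= r)%N.
Proof.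
rewrite !inE/=; case: leqP => [xr|]; rewrite ?andbF// andbT.
have xj j : (`|x ord0 j| <= r)%N.
  by apply: leq_trans xr; rewrite /site_norm (bigD1 j)//= leq_addr.
have b j : (absz (x ord0 j + r%:Z)%R < 2 * r + 1)%N by have := xj j; lia.
apply/mapP; exists [ffun j => Ordinal (b j)]; first by rewrite mem_enum.
apply/rowP => j; rewrite !mxE ffunE /= (_ : x 0%R j = x ord0 j)//.
by have := xj j; lia.
Qed.

Lemma card_lattice_ball r : (#|` lattice_ball r| <= (2 * r + 1) ^ d)%N.
Proof.
have -> : ((2 * r + 1) ^ d = size (lattice_box r))%N.
  by rewrite size_map -cardE card_ffun !card_ord.
apply: uniq_leq_size; first exact: fset_uniq.
by move=> x; rewrite !inE => /andP[].
Qed.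

Lemma lattice_ball_mono : {homo lattice_ball : i j / (i <= j)%N >-> (i `<=` j)%fset}.
Proof.
by move=> i j ij; apply/fsubsetP => x; rewrite !mem_lattice_ball => /leq_trans; apply.
Qed.

Lemma lattice_ball_exhaust (F : {fset 'rV[int]_d}) :
  exists k, (F `<=` lattice_ball k)%fset.
Proof.
exists (\max_(x <- F) site_norm x)%N; apply/fsubsetP => x xF.
by rewrite mem_lattice_ball; exact: leq_bigmax_seq.
Qed.

End LatticeBall.

Section Tempered.
Context {R : realType} (d : nat).
Local Notation X := (config R (Lattice d)).

(** Telescoping: each term is 1/(k+1) - 1/(k+2). The weights in [tempered_ae] are chosen to end in
    this sum, which stays below 1. *)
Lemma sum_inv_pronic n :
  \sum_(0 <= k < n) ((k.+1 * k.+2)%:R : R)^-1 = 1 - n.+1%:R^-1.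
Proof.
elim: n => [|n IH]; first by rewrite big_geq// invr1 subrr.
rewrite big_nat_recr//= IH natrM.
have a0 : (n.+1%:R : R) != 0 by rewrite pnatr_eq0.
have a1 : (n.+1%:R + 1 : R) != 0 by rewrite natr1 pnatr_eq0.
rewrite -[n.+2%:R]natr1; move: (n.+1%:R : R) a0 a1 => a a0 a1.
by field; rewrite a0 a1.
Qed.

(* Summing the second moments over balls with summable polynomial weights
   gives an integrable function that dominates every coordinate. *)
Lemma tempered_ae (nu : probability X R) (C : R) :
  (forall x : 'rV[int]_d, (\int[nu]_eta ((eta : X) x ^+ 2)%:E <= C%:E)%E) ->
  {ae nu, forall eta : X, tempered eta}.
Proof.
move=> nuC.
have C0 : 0 <= C.
  by rewrite -lee_fin; apply: le_trans (nuC 0); apply: integral_ge0 => eta _; rewrite lee_fin sqr_ge0.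
(* The second factor offsets the number of points of the ball, so [g r] has integral at most
   C/((r+1)(r+2)), and these bounds sum to at most C. *)
pose w (r : nat) : R := ((r.+1 * r.+2)%:R * ((2 * r + 1) ^ d)%:R)^-1.
have w0 r : 0 < w r by rewrite invr_gt0 mulr_gt0// ltr0n ?muln_gt0// expn_gt0 addn1.
pose g (r : nat) (eta : X) : R := w r * \sum_(x <- lattice_ball d r) eta x ^+ 2.
have g0 r eta : 0 <= g r eta.
  by apply: mulr_ge0; [exact: ltW|apply: sumr_ge0 => x _; rewrite sqr_ge0].
have mx (x : 'rV[int]_d) : measurable_fun [set: X] (fun eta : X => eta x ^+ 2).
  apply: measurable_funX; exact: (@measurable_eval R (Lattice d) x).
have mg r : measurable_fun [set: X] (fun eta => (g r eta)%:E).
  apply/measurable_EFinP; apply: measurable_funM; first exact: measurable_cst.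
  exact: measurable_sum.
have intg r : (\int[nu]_eta (g r eta)%:E <= (C * ((r.+1 * r.+2)%:R)^-1)%:E)%E.
  under eq_integral do rewrite EFinM.
  have mS : measurable_fun [set: X] (fun eta : X => (\sum_(x <- lattice_ball d r) eta x ^+ 2)%:E).
    by apply/measurable_EFinP; exact: measurable_sum.
  rewrite (ge0_integralZl _ measurableT mS); last 2 first.
  - by move=> eta _; rewrite lee_fin sumr_ge0// => x _; rewrite sqr_ge0.
  - by rewrite lee_fin ltW.
  under eq_integral do rewrite -sumEFin.
  rewrite ge0_integral_sum//; last 2 first.
  - by move=> x; apply/measurable_EFinP; exact: mx.
  - by move=> x eta _; rewrite lee_fin sqr_ge0.
  apply: (@le_trans _ _ ((w r)%:E * (\sum_(x <- lattice_ball d r) C)%:E)%E).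
    rewrite lee_wpmul2l ?lee_fin ?(ltW (w0 r))// -sumEFin.
    elim/big_ind2: _ => [|a b c e|k _]; [by []|exact: leeD|exact: nuC].
  rewrite -EFinM lee_fin big_const_seq count_predT iter_addr_0 -[C *+ _]mulr_natr.
  rewrite /w; set P : R := (r.+1 * r.+2)%:R; set V : R := ((2 * r + 1) ^ d)%:R.
  have P0 : 0 < P by rewrite ltr0n muln_gt0.
  have V0 : 0 < V by rewrite ltr0n expn_gt0 addn1.
  rewrite ler_pdivrMl ?mulr_gt0//.
  have -> : P * V * (C / P) = C * V by rewrite mulrC mulrA divfK ?gt_eqF.
  by rewrite ler_wpM2l// ler_nat card_lattice_ball.
pose G (eta : X) := (\sum_(r <oo) (g r eta)%:E)%E.
have mG : measurable_fun [set: X] G.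
  by apply: ge0_emeasurable_sum => // r eta _ _; rewrite lee_fin.
have G0 eta : (0 <= G eta)%E by apply: nneseries_ge0 => r _ _; rewrite lee_fin.
have intG : (\int[nu]_eta G eta <= C%:E)%E.
  rewrite integral_nneseries//; last by move=> n eta _; rewrite lee_fin.
  apply: lime_le; first by apply: is_cvg_nneseries => r _ _; apply: integral_ge0 => eta _; rewrite lee_fin.
  apply: nearW => n; apply: (@le_trans _ _ (\sum_(0 <= r < n) (C * ((r.+1 * r.+2)%:R)^-1)%:E)%E).
    by apply: lee_sum => r _; exact: intg.
  by rewrite sumEFin lee_fin -mulr_sumr sum_inv_pronic ler_piMr// gerBl invr_ge0.
have : nu.-integrable setT G.
  apply/integrableP; split; first exact: mG.
  under eq_integral do rewrite gee0_abs//.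
  exact: le_lt_trans intG (ltry C).
move=> /(integrable_ae measurableT) aeG.
apply: filterS aeG => eta /(_ I) Gfin.
(* For r the norm of x, the term [g r eta] bounds [eta x ^+ 2] by [fine (G eta) / w r]. Both r + 2
   and 2r + 1 are at most 2(1 + r), whence the factor 2 times 2^d and the exponent d + 2; the
   summand 1 comes from |a| <= 1 + a^2. *)
exists (1 + 2 * 2 ^+ d * fine (G eta)), (d + 2)%N => x.
pose r := site_norm x.
have gG : g r eta <= fine (G eta).
  rewrite -lee_fin fineK//; apply: le_trans (nneseries_lim_ge r.+1 _); last first.
    by move=> k _ _; rewrite lee_fin.
  rewrite sumEFin lee_fin big_nat_recr//= lerDr; exact: sumr_ge0.
have s0 : 0 <= fine (G eta) by apply: le_trans gG.
have ex : eta x ^+ 2 <= fine (G eta) * (w r)^-1.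
  rewrite ler_pdivlMr// mulrC; apply: le_trans gG.
  rewrite ler_pM2l// (big_fsetD1 x)/= ?mem_lattice_ball// lerDl.
  by apply: sumr_ge0 => y _; rewrite sqr_ge0.
have wr : (w r)^-1 <= 2 * 2 ^+ d * (1 + r)%:R ^+ (d + 2).
  have -> : 2 * 2 ^+ d * (1 + r)%:R ^+ (d + 2) =
      ((2 * (1 + r) ^ 2) * (2 * (1 + r)) ^ d)%:R :> R.
    by rewrite exprD !(natrM, natrX) exprMn; ring.
  rewrite invrK -natrM ler_nat leq_mul//; first by nia.
  by case: (d) => // k; rewrite leq_exp2r//; lia.
have e1 : `|eta x| <= 1 + eta x ^+ 2.
  rewrite -real_normK ?num_real//; have := sqr_ge0 (`|eta x| - 1); nra.
apply: (le_trans e1).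
have r1 : 1 <= (1 + r)%:R ^+ (d + 2) :> R by rewrite exprn_ege1// ler1n.
rewrite mulrDl mul1r; apply: lerD => //; apply: (le_trans ex).
by rewrite mulrC [leRHS]mulrAC ler_wpM2r.
Qed.

End Tempered.

(** * Passage to the limit *)

Lemma cvgr_prod (R : realType) (I : finType) (f : I -> nat -> R) (l : I -> R) :
  (forall i, f i k @[k --> \oo] --> l i) ->
  \prod_i f i k @[k --> \oo] --> \prod_i l i.
Proof.
move=> fl; elim: (index_enum I) => [|i r IH].
  by rewrite big_nil; under eq_fun do rewrite big_nil; exact: cvg_cst.
by rewrite big_cons; under eq_fun do rewrite big_cons; exact: cvgM.
Qed.

(** Two independent walkers from the same site meet with probability at least 1/|T| at every time,
    by Cauchy-Schwarz; the proof sums the tangent inequality 2aw - a^2 <= w^2 with a = 1/|T|. *)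
Lemma finite_meeting_positive (R : realType) (T : finType)
    (W : R -> T -> T -> R) (p : sites (FiniteSet T) -> sites (FiniteSet T) -> R)
    (x : T) :
  markov_transition (walk_rate p) (W : R -> sites (FiniteSet T) -> sites (FiniteSet T) -> R) ->
  ~ irw_meeting_vanishes (S := FiniteSet T) W.
Proof.
move=> W_chain hA1.
pose m : R := #|T|%:R.
have m0 : 0 < m by rewrite ltr0n; apply/card_gt0P; exists x.
have lt0 : (0 < (m^-1)%:E)%E by rewrite lte_fin invr_gt0.
have [t [t0]] : exists t : R, 0 <= t /\
    (ereal_sup [set \esum_(z in [set: T]) (W t xy.1 z * W t xy.2 z)%:E
      | xy in [set: T * T]] < (m^-1)%:E)%E.
  have [t tP] := @filter_ex _ _ _ _ (filterI (nbhs_pinfty_ge (num_real (0:R)))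
    (hA1 _ (open_ereal_lt' lt0))).
  by exists t; case: tP.
apply/negP; rewrite -leNgt.
have esumE (a : T -> R) : (forall z, 0 <= a z) ->
    (\esum_(z in [set: T]) (a z)%:E = (\sum_z a z)%:E)%E.
  move=> a0; rewrite esum_fset; [|exact: finite_finset|by move=> z _; rewrite lee_fin].
  have -> : [set: T] = [set` index_enum T].
    by apply/seteqP; split => z //= _; rewrite mem_index_enum.
  by rewrite -fsbig_seq ?index_enum_uniq// sumEFin.
have W0 z : 0 <= W t x z by rewrite (mt_ge0 W_chain).
have W1 : \sum_z W t x z = 1.
  by apply: EFin_inj; rewrite -esumE// (mt_sum1 W_chain).
apply: le_trans (ereal_sup_ubound _); last by exists (x, x).
rewrite esumE/=; last by move=> z; rewrite mulr_ge0.
rewrite lee_fin.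
apply: (@le_trans _ _ (\sum_(z : T) (2 * m^-1 * W t x z - m^-1 ^+ 2))).
  have E : (m^-1 ^+ 2) *+ #|T| = m^-1.
    by rewrite -[LHS]mulr_natr -/m expr2 -mulrA mulVf ?gt_eqF// mulr1.
  by rewrite sumrB -mulr_sumr W1 sumr_const E; lra.
apply: ler_sum => z _; have := sqr_ge0 (W t x z - m^-1); nra.
Qed.

Section LatticeCase.
Context {R : realType} (d : nat).
Notation S := (Lattice d).
Variable p : sites S -> sites S -> R.
Hypothesis p_walk : random_walk p.

Lemma lattice_neighbours : exists N : sites S -> {fset (sites S)},
  (forall x y, y \notin N x -> p x y = 0) /\
  (forall x, \sum_(y <- N x) p x y = 1).
Proof.
have [_ [r pr]] := rw_homogeneous p_walk.
pose N (x : sites S) : {fset (sites S)} := [fset ((x : 'rV[int]_d) + z)%R | z in lattice_ball d r]%fset.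
have Np x y : y \notin N x -> p x y = 0.
  move=> yN; apply: pr; rewrite ltnNge -mem_lattice_ball; apply: contra yN => yx.
  by apply/imfsetP; exists (y - x) => //=; rewrite addrC subrK.
move: (N) Np => {}N Np; exists N; split=> // x; apply: EFin_inj; rewrite -(rw_sum1 p_walk x).
transitivity (\esum_(y in [set` N x]) (p x y)%:E).
  rewrite esum_fset; [|exact: finite_fset|by move=> y _; rewrite lee_fin (rw_ge0 p_walk)].
  by rewrite fsbig_finite// set_fsetK sumEFin.
rewrite esum_mkcond; apply: eq_esum => y _; case: ifPn => // yN.
by rewrite Np//; apply: contra yN => yN; apply/mem_set.
Qed.

Variable P2 : R -> sites S * sites S -> sites S * sites S -> R.
Hypothesis P2_chain : markov_transition (sip2_rate p) P2.
Variable Q : R -> particles S -> particles S -> R.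
Hypothesis Q_chain : markov_transition (sip_rate p) Q.
Variable B : R -> R.-pker (config R S) ~> (config R S).
Hypothesis B_bmp : brownian_momentum p Q B.
Hypothesis hA2 : sip_meeting_vanishes P2.
Variables nu mu : probability (config R S) R.
Hypothesis nu_moments : finite_moments nu.
Hypothesis nu_product : product_measure nu.

Let M (xi : particles S) : \bar R := (\int[nu]_eta (D xi eta)%:E)%E.
Let rho (x : sites S) : R := fine (\int[nu]_eta ((eta : config R S) x ^+ 2)%:E)%E.

Let M1 x : M [mset x]%mset = (\int[nu]_eta ((eta : config R S) x ^+ 2)%:E)%E.
Proof.
by apply: eq_integral => eta _; rewrite D_uniq enum_msetn//= big_seq1.
Qed.

Lemma second_moments_bounded : exists2 r : R, 0 <= r &
  forall x : sites S, (\int[nu]_eta ((eta : config R S) x ^+ 2)%:E <= r%:E)%E.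
Proof.
have := nu_moments 1; set s := ereal_sup _ => sfin.
have sM x : (M [mset x]%mset <= s)%E.
  by apply: ereal_sup_ubound; exists [mset x]%mset => //=; rewrite enum_msetn.
have s0 : (0 <= s)%E.
  by apply: le_trans (sM 0); apply: integral_ge0 => eta _; rewrite lee_fin D_ge0.
exists (fine s); first exact: fine_ge0.
by move=> x; rewrite fineK ?ge0_fin_numE// -M1.
Qed.

Let rho_fin x : (\int[nu]_eta ((eta : config R S) x ^+ 2)%:E)%E \is a fin_num.
Proof.
have [r r0 rP] := second_moments_bounded.
rewrite ge0_fin_numE; first exact: le_lt_trans (rP x) (ltry r).
by apply: integral_ge0 => eta _; rewrite lee_fin sqr_ge0.
Qed.

(** Duality is given from tempered configurations; bounded second moments make these [nu]-almost
    sure. *)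
Lemma moment_evolve_sip (t : R) xi : 0 <= t ->
  (\int[evolve nu (B t)]_eta (D xi eta)%:E)%E = sip_moment Q M t xi.
Proof.
move=> t0; have [r r0 rP] := second_moments_bounded.
by apply: (moment_evolve _ (tempered_ae rP)) => [xi'|eta teta];
  [exact: (mt_ge0 Q_chain)|exact: (bmp_duality B_bmp)].
Qed.

Let M_ge0 xi : (0 <= M xi)%E.
Proof. by apply: integral_ge0 => eta _; rewrite lee_fin D_ge0. Qed.

Let M_uniq (xi : particles S) : uniq xi -> M xi = (weight rho xi)%:E.
Proof.
move=> u; rewrite /M integral_D_uniq// -prodEFin; apply: eq_bigr => y _.
by rewrite fineK.
Qed.

Let rho_ge0 x : 0 <= rho x.
Proof. by apply/fine_ge0/integral_ge0 => eta _; rewrite lee_fin sqr_ge0. Qed.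

Lemma moment1_bound : exists r : R, forall (t : R) x, 0 <= t ->
  [/\ (sip_moment Q M t [mset x]%mset <= r%:E)%E,
     sip_moment Q M t [mset x]%mset \is a fin_num &
     walk_mass Q rho (lattice_ball d k) t x @[k --> \oo] -->
       fine (sip_moment Q M t [mset x]%mset)].
Proof.
have [N [Np N1]] := lattice_neighbours.
have [r r0 rP] := second_moments_bounded; exists r => t x t0.
have rho_le y : rho y <= r by rewrite -lee_fin fineK.
by have [? []] := sip_moment1 (rw_ge0 p_walk) Np N1 Q_chain M_uniq rho_ge0
  r0 rho_le x (@lattice_ball_mono d) (@lattice_ball_exhaust d) t0.
Qed.

(** The balls exhaust the lattice while t is fixed. The constant [c] depends on neither t nor [e],
    so [e] can be made small along the times afterwards. *)
Lemma moment_lower_bound n (x : 'I_n -> sites S) : exists2 c : R, 0 <= c &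
  forall (t e : R), 0 <= t -> 0 <= e ->
  (ereal_sup [set \esum_(z in [set: sites S]) (P2 t xy (z, z))%:E
    | xy in [set: sites S * sites S]] <= e%:E)%E ->
  ((\prod_i fine (sip_moment Q M t [mset x i]%mset) - c * e)%:E <=
    sip_moment Q M t (pile x))%E.
Proof.
have [N [Np N1]] := lattice_neighbours.
have [r r0 rP] := second_moments_bounded.
have rho_le y : rho y <= r by rewrite -lee_fin fineK.
have [r' walkP] := moment1_bound.
exists (r ^+ n * n%:R ^+ 2); first by rewrite mulr_ge0 ?exprn_ge0.
move=> t e t0 e0 supe.
have cvgP : (\prod_i walk_mass Q rho (lattice_ball d k) t (x i) - r ^+ n * (n%:R ^+ 2 * e))%:E
    @[k --> \oo] --> (\prod_i fine (sip_moment Q M t [mset x i]%mset) - r ^+ n * n%:R ^+ 2 * e)%:E.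
  apply: cvg_EFin; first exact: nearW.
  rewrite -mulrA; apply: cvgB; last exact: cvg_cst.
  by apply: cvgr_prod => i; have [] := walkP t (x i) t0.
apply: cvge_to_le cvgP _; apply: nearW => k.
exact: (sip_moment_lower (rw_ge0 p_walk) (rw_sym p_walk) (rw_diag p_walk) Np N1
  P2_chain Q_chain M_ge0 M_uniq rho_ge0 r0 rho_le).
Qed.

End LatticeCase.

Theorem proposition4 (R : realType) (S : site_space)
    (p : sites S -> sites S -> R) (p_walk : random_walk p)
    (W : R -> sites S -> sites S -> R)
    (W_chain : markov_transition (walk_rate p) W)
    (P2 : R -> sites S * sites S -> sites S * sites S -> R)
    (P2_chain : markov_transition (sip2_rate p) P2)
    (Q : R -> particles S -> particles S -> R)
    (Q_chain : markov_transition (sip_rate p) Q)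
    (B : R -> R.-pker (config R S) ~> (config R S))
    (B_bmp : brownian_momentum p Q B)
    (hA1 : irw_meeting_vanishes W) (hA2 : sip_meeting_vanishes P2)
    (nu mu : probability (config R S) R)
    (nu_moments : finite_moments nu) (nu_product : product_measure nu)
    (t_ : nat -> R) (t_ge0 : forall k, 0 <= t_ k)
    (t_nd : {homo t_ : k l / (k <= l)%N >-> k <= l})
    (t_oo : t_ k @[k --> \oo] --> +oo)
    (mu_limit : moment_cvg (fun k => evolve nu (B (t_ k))) mu)
    (n : nat) (n_gt0 : (0 < n)%N) (x : n.-tuple (sites S)) :
  (\prod_(i < n) K mu [:: tnth x i] <= K mu x)%E.
Proof.
case: S p p_walk W W_chain P2 P2_chain Q Q_chain B B_bmp hA1 hA2 nu mu nu_moments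
  nu_product mu_limit x => [T|d] p p_walk W W_chain P2 P2_chain Q Q_chain B B_bmp
  hA1 hA2 nu mu nu_moments nu_product mu_limit x.
  (* Positivity of [n] supplies the starting site. *)
  have := @finite_meeting_positive R T W p (tnth x (Ordinal n_gt0)) W_chain hA1.
  by [].
have [r rP] := moment1_bound p_walk Q_chain nu_moments nu_product.
have [c c0 cP] := moment_lower_bound p_walk P2_chain Q_chain nu_moments nu_product (tnth x).
pose A k xi := sip_moment Q (fun xi => \int[nu]_eta (D xi eta)%:E)%E (t_ k) xi.
have AE k xi : (\int[evolve nu (B (t_ k))]_eta (D xi eta)%:E)%E = A k xi.
  by rewrite (moment_evolve_sip Q_chain B_bmp).
have A_cvg xi : A k xi @[k --> \oo] --> (\int[mu]_eta (D xi eta)%:E)%E.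
  by have := mu_limit xi; under eq_fun do rewrite AE.
pose kap i := fine (K mu [:: tnth x i]).
have KE i : K mu [:: tnth x i] = (\int[mu]_eta (D [mset tnth x i]%mset eta)%:E)%E.
  rewrite /K; apply: eq_integral => eta _; do 2! f_equal.
  by apply/msetP => y; rewrite mset_seqE msetnE/= addn0 eq_sym; case: eqP.
(* The bound [r] on one-point moments is uniform in time, so it passes to the limit and the product
   can be treated in the reals. *)
have Kfin i : K mu [:: tnth x i] \is a fin_num.
  rewrite ge0_fin_numE; last by apply: integral_ge0 => eta _; rewrite lee_fin D_ge0.
  apply: (@le_lt_trans _ _ r%:E); last exact: ltry.
  rewrite KE; apply: cvge_to_le (A_cvg _) _; apply: nearW => k.
  by have [] := rP (t_ k) (tnth x i) (t_ge0 k).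
have prod_cvg : \prod_i fine (A k [mset tnth x i]%mset) @[k --> \oo] --> \prod_i kap i.
  apply: cvgr_prod => i.
  have : A k [mset tnth x i]%mset @[k --> \oo] --> (kap i)%:E by rewrite fineK// KE.
  by move=> /fine_cvg.
have -> : (\prod_(i < n) K mu [:: tnth x i] = (\prod_i kap i)%:E)%E.
  by rewrite -prodEFin; apply: eq_bigr => i _; rewrite fineK.
have -> : K mu x = (\int[mu]_eta (D (pile (tnth x)) eta)%:E)%E.
  by rewrite /K /pile map_tnth_enum.
(* The divisor c + 1 covers the case c = 0 and still gives [c * e' <= e]. *)
apply/lee_subgt0Pr => e e0; pose e' := e / (c + 1).
have c1 : 0 < c + 1 by rewrite ltr_wpDl.
have e'0 : 0 < e' by rewrite divr_gt0.
have le_e : c * e' <= e by rewrite mulrA ler_pdivrMr// mulrDr mulr1 mulrC lerDl ltW.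
apply: (@le_trans _ _ (\prod_i kap i - c * e')%:E).
  by rewrite -EFinB lee_fin lerB.
have lower_cvg : (\prod_i fine (A k [mset tnth x i]%mset) - c * e')%:E @[k --> \oo]
    --> (\prod_i kap i - c * e')%:E.
  by apply: cvg_EFin; [exact: nearW|apply: cvgB => //; exact: cvg_cst].
apply: lee_cvg_to lower_cvg (A_cvg _) _.
have lt0 : (0 < e'%:E)%E by rewrite lte_fin.
have supP : \forall k \near \oo, (ereal_sup [set \esum_(z in [set: sites (Lattice d)])
    (P2 (t_ k) xy (z, z))%:E | xy in [set: sites (Lattice d) * sites (Lattice d)]] < e'%:E)%E.
  exact: (t_oo _ (hA2 _ (open_ereal_lt' lt0))).
apply: filterS supP => k supk.
by apply: cP => //; exact: ltW.
Qed.
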